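(* Let $n\ge 0$ be an integer, let $F$ be a free group, $B$ a finitely related group, and $\phi:F\to B$ a homomorphism that induces a monomorphism $H_1(F;\mathbb{Q})\to H_1(B;\mathbb{Q})$. Suppose that $H_2(B;\mathbb{Q})$ is spanned by $B^{(n)}$-surfaces (or, more generally, by $B^{(n)}_H$-surfaces). Then $\phi$ induces a monomorphism $$F/F^{(n+1)}\hookrightarrow B/B^{(n+1)},$$ and similarly $\phi$ induces a monomorphism $F/F^{(m)}\hookrightarrow B/B^{(m)}$ for every $m\le n+1$.
   Context: A group is finitely related if it admits a presentation with finitely many relators (possibly infinitely many generators). $G^{(n)}$ is the derived series: $G^{(0)}=G$, $G^{(n+1)}=[G^{(n)},G^{(n)}]$. Torsion-free derived series of a group $G$: $G^{(0)}_H=G$. Given the normal subgroup $G^{(n)}_H$ of $G$, the abelian group $G^{(n)}_H/[G^{(n)}_H,G^{(n)}_H]$ is a right $\mathbb{Z}[G/G^{(n)}_H]$-module via $[x]g=[g^{-1}xg]$. Let $T_n$ be its subset of torsion elements, i.e. those $[x]$ with $[x]\gamma=0$ for some nonzero $\gamma\in\mathbb{Z}[G/G^{(n)}_H]$ (this is a submodule). Then $G^{(n+1)}_H$ is the inverse image of $T_n$ under $G^{(n)}_H\to G^{(n)}_H/[G^{(n)}_H,G^{(n)}_H]$. One has $G^{(n)}\subset G^{(n)}_H$. For a normal subgroup $N$ of $B$, an $N$-surface of $B$ is a map $f:\Sigma\to K(B,1)$ of a closed oriented surface with $f_*(\pi_1(\Sigma))\subset N$; ''$H_2(B;\mathbb{Q})$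 is spanned by $N$-surfaces'' means that the map $H_2(N;\mathbb{Q})\to H_2(B;\mathbb{Q})$ induced by inclusion is surjective. *)

(* Defs.v *)
From HB Require Import structures.
From mathcomp Require Import all_boot all_order all_algebra.
From mathcomp Require Import boolp classical_sets.
From mathcomp.multinomials Require Import freeg.

Set Implicit Arguments.
Unset Strict Implicit.
Unset Printing Implicit Defensive.

Import GRing.Theory.

Local Open Scope classical_set_scope.
Local Open Scope quotient_scope.
Local Open Scope group_scope.

(* [groupType] is the class of all (possibly infinite) groups. *)
Notation "{ 'ghom' G -> K }" := (UMagmaMorphism.type G%type K%type)
  (at level 0, G at level 98, K at level 99, format "{ 'ghom'  G  ->  K }") : type_scope.

Section Subgroups.
Context (G : groupType).
Implicit Types (A S : set G) (x y g : G).

Definition is_subgroup A := A 1 /\ forall x y, A x -> A y -> A (x / y).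

Definition is_normal A :=
  is_subgroup A /\ forall x g, A x -> A (x ^ g).

Definition generated S : set G :=
  [set x | forall A, is_subgroup A -> S `<=` A -> A x].

Definition normal_closure S : set G :=
  [set x | forall A, is_normal A -> S `<=` A -> A x].

Definition commutator_subgroup A : set G :=
  generated [set z | exists x y, [/\ A x, A y & z = [~ x, y]]].

Record normal_subgroup := NormalSubgroup {
  normal_set :> set G;
  normal_setP : is_normal normal_set }.

Lemma is_subgroup_setT : is_subgroup setT. Proof. by []. Qed.

Lemma is_normal_setT : is_normal setT. Proof. by []. Qed.

Lemma subgroupV A x : is_subgroup A -> A x -> A x^-1.
Proof. by move=> [A1 AF] Ax; rewrite -div1g; exact: AF. Qed.

Lemma subgroupM A x y : is_subgroup A -> A x -> A y -> A (x * y).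
Proof.
move=> sA Ax Ay; rewrite -[y]invgK.
by apply: sA.2 => //; apply: subgroupV.
Qed.

Lemma generated_sub S : S `<=` generated S.
Proof. by move=> x Sx A _; exact. Qed.

Lemma generated_min S A : is_subgroup A -> S `<=` A -> generated S `<=` A.
Proof. by move=> sA SA x; exact. Qed.

Lemma generated_subgroup S : is_subgroup (generated S).
Proof.
split=> [A sA _|x y gx gy A sA SA]; first exact: sA.1.
by apply: sA.2; [exact: gx | exact: gy].
Qed.

Lemma normal_closure_normal S : is_normal (normal_closure S).
Proof.
split; first split=> [A nA _|x y gx gy A nA SA]; first exact: nA.1.1.
  by apply: nA.1.2; [exact: gx | exact: gy].
by move=> x g gx A nA SA; apply: nA.2; exact: gx.
Qed.

Lemma normal_closure_id A : is_normal A -> normal_closure A = A.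
Proof.
move=> nA; apply/seteqP; split=> [x|x Ax B _]; last exact.
exact.
Qed.

Lemma commutator_subgroup_normal A :
  is_normal A -> is_normal (commutator_subgroup A).
Proof.
move=> nA; split; first exact: generated_subgroup.
move=> x g gx B sB SB.
apply: (gx [set y | B (y ^ g)]).
  split=> [|y z /= By Bz]; first by rewrite /= conj1g; exact: sB.1.
  by rewrite conjMg conjVg; exact: sB.2.
move=> _ [y [z [Ay Az ->]]] /=; rewrite conjRg; apply: SB.
by exists (y ^ g), (z ^ g); split=> //; apply: nA.2.
Qed.

Definition normal_closureN S := NormalSubgroup (normal_closure_normal S).

Definition commutatorN (N : normal_subgroup) :=
  NormalSubgroup (commutator_subgroup_normal (normal_setP N)).

Definition wholeN := NormalSubgroup is_normal_setT.

Fixpoint derived n : normal_subgroup :=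
  if n is m.+1 then commutatorN (derived m) else wholeN.

End Subgroups.

Lemma derived_map (G K : groupType) (phi : {ghom G -> K}) n x :
  (derived G n : set G) x -> (derived K n : set K) (phi x).
Proof.
elim: n x => // m IHm x.
apply: (generated_min (A := [set x | _])) => [|_ [y [z [Gy Gz ->]]]] /=.
  have [K1 KF] := (normal_setP (derived K m.+1)).1.
  split=> [|y z] /=; first by rewrite gmulf1.
  by rewrite gmulfF; exact: KF.
apply: generated_sub; exists (phi y), (phi z).
by split; [exact: IHm | exact: IHm | rewrite gmulfR].
Qed.

Section SubgroupType.
Context (G : groupType) (N : normal_subgroup G).

Definition subgrp := set_type N.

HB.instance Definition _ := SubChoice.on subgrp.

Lemma subgrp_closed : group_closed [in (N : set G)].
Proof.
have [[N1 NF] _] := normal_setP N.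
by split=> [|x y]; rewrite !inE //; exact: NF.
Qed.

HB.instance Definition _ :=
  SubChoice_isSubGroup.Build G _ subgrp subgrp_closed.

End SubgroupType.

Section QuotientGroup.
Context (G : groupType) (N : normal_subgroup G).

Definition coset_rel (x y : G) := x^-1 * y \in (N : set G).

Lemma coset_rel_equiv : equiv_class_of coset_rel.
Proof.
have sN := (normal_setP N).1.
split=> [x|x y|y x z]; rewrite /coset_rel ?mulVg.
- by rewrite inE; exact: sN.1.
- by apply/idP/idP; rewrite !inE => /(subgroupV sN); rewrite invgM invgK.
- rewrite !inE => Nxy Nyz; rewrite -[z](mulVKg y) mulgA.
  exact: subgroupM.
Qed.

Canonical coset_rel_equiv_rel := EquivRelPack coset_rel_equiv.
Canonical coset_rel_encModRel := defaultEncModRel coset_rel.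

Definition quotg := {eq_quot coset_rel}.

HB.instance Definition _ : EqQuotient G coset_rel quotg := EqQuotient.on quotg.
HB.instance Definition _ := Choice.on quotg.

Definition quotg_one : quotg := lift_cst quotg 1.
Definition quotg_inv := lift_op1 quotg (fun x => x^-1).
Definition quotg_mul := lift_op2 quotg (fun x y => x * y).

Lemma quotgP x y : \pi_quotg x = \pi_quotg y <-> (N : set G) (x^-1 * y).
Proof.
split=> [/eqmodP|]; first by rewrite /= /coset_rel inE.
by move=> Nxy; apply/eqmodP; rewrite /= /coset_rel inE.
Qed.

Lemma quotg_reprP x : (N : set G) ((repr (\pi_quotg x))^-1 * x).
Proof. by apply/quotgP; rewrite reprK. Qed.

Canonical pi_quotg_one := PiConst quotg_one.

Lemma pi_quotgM : {morph \pi_quotg : x y / x * y >-> quotg_mul x y}.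
Proof.
move=> x y; unlock quotg_mul; apply/esym/quotgP.
set a := repr _; set b := repr _.
have Na : (N : set G) (a^-1 * x) by exact: quotg_reprP.
have Nb : (N : set G) (b^-1 * y) by exact: quotg_reprP.
have -> : (a * b)^-1 * (x * y) = (a^-1 * x) ^ b * (b^-1 * y).
  by rewrite conjgE invgM !mulgA mulgK.
by apply: (subgroupM (normal_setP N).1) => //; exact: (normal_setP N).2.
Qed.
Canonical pi_quotg_mul := PiMorph2 pi_quotgM.

Lemma pi_quotgV : {morph \pi_quotg : x / x^-1 >-> quotg_inv x}.
Proof.
move=> x; unlock quotg_inv; apply/esym/quotgP; set a := repr _.
have Na : (N : set G) (a^-1 * x) by exact: quotg_reprP.
have -> : (a^-1)^-1 * x^-1 = ((a^-1 * x) ^ a^-1)^-1.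
  by rewrite conjgE !invgM !invgK !mulgA mulgK.
exact/(subgroupV (normal_setP N).1)/(normal_setP N).2.
Qed.
Canonical pi_quotg_inv := PiMorph1 pi_quotgV.

Lemma quotg_mulA : associative quotg_mul.
Proof. by move=> a b c; rewrite -[a]reprK -[b]reprK -[c]reprK !piE mulgA. Qed.

Lemma quotg_mul1 : left_id quotg_one quotg_mul.
Proof. by move=> a; rewrite -[a]reprK !piE mul1g. Qed.

Lemma quotg_mulr1 : right_id quotg_one quotg_mul.
Proof. by move=> a; rewrite -[a]reprK !piE mulg1. Qed.

Lemma quotg_mulV : left_inverse quotg_one quotg_inv quotg_mul.
Proof. by move=> a; rewrite -[a]reprK !piE mulVg. Qed.

Lemma quotg_mulrV : right_inverse quotg_one quotg_inv quotg_mul.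
Proof. by move=> a; rewrite -[a]reprK !piE mulgV. Qed.

HB.instance Definition _ := isGroup.Build quotg
  quotg_mulA quotg_mul1 quotg_mulr1 quotg_mulV quotg_mulrV.

HB.instance Definition _ :=
  isMultiplicative.Build G quotg \pi_quotg pi_quotgM.

Lemma pi_quotg1 : \pi_quotg 1 = 1 :> quotg.
Proof. by rewrite -[RHS]/quotg_one; unlock quotg_one. Qed.

HB.instance Definition _ :=
  Multiplicative_isUMagmaMorphism.Build G quotg \pi_quotg pi_quotg1.

End QuotientGroup.

Section Abelianization.
Context (H : groupType).

Definition abelianization := quotg (commutatorN (wholeN H)).

HB.instance Definition _ := Choice.on abelianization.

Definition ab_class (x : H) : abelianization := \pi x.

Let zero : abelianization := (1 : quotg _).
Let opp (a : abelianization) : abelianization := (a : quotg _)^-1.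
Let add (a b : abelianization) : abelianization := (a : quotg _) * b.

Lemma ab_addA : associative add. Proof. exact: mulgA. Qed.

Lemma ab_addC : commutative add.
Proof.
move=> a b; rewrite /add -[a]reprK -[b]reprK -!gmulfM.
apply/quotgP; apply: generated_sub.
exists (repr b), (repr a); split=> //.
by rewrite /commg /conjg invgM !mulgA.
Qed.

Lemma ab_add0 : left_id zero add. Proof. exact: mul1g. Qed.

Lemma ab_addN : left_inverse zero opp add. Proof. exact: mulVg. Qed.

HB.instance Definition _ :=
  GRing.isZmodule.Build abelianization ab_addA ab_addC ab_add0 ab_addN.

End Abelianization.

Section TorsionFreeDerivedSeries.
Context (G : groupType).

Section Step.
Variable N : normal_subgroup G.

Lemma subgrp_conj_in (x : subgrp N) (g : G) : val x ^ g \in (N : set G).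
Proof. by rewrite inE; apply: (normal_setP N).2; exact: set_mem (valP x). Qed.

Definition subgrp_conj (g : G) (x : subgrp N) : subgrp N :=
  Sub (val x ^ g) (subgrp_conj_in x g).

(* The right action of G/N on N/[N,N], [x]g = [g^-1 x g]: see [ab_conjE]. *)
Definition ab_conj (m : abelianization (subgrp N)) (q : quotg N) :
    abelianization (subgrp N) :=
  ab_class (subgrp_conj (repr q) (repr m)).

Lemma subgrp_conjM g : {morph subgrp_conj g : x y / x * y}.
Proof. by move=> x y; apply: val_inj; rewrite /= conjMg. Qed.

Lemma subgrp_conj1 g : subgrp_conj g 1 = 1.
Proof. by apply: val_inj; rewrite /= conj1g. Qed.

HB.instance Definition _ g := isMultiplicative.Build
  (subgrp N) (subgrp N) (subgrp_conj g) (subgrp_conjM g).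
HB.instance Definition _ g := Multiplicative_isUMagmaMorphism.Build
  (subgrp N) (subgrp N) (subgrp_conj g) (subgrp_conj1 g).

Lemma ab_conjE x g :
  ab_conj (ab_class x) (\pi g) = ab_class (subgrp_conj g x).
Proof.
rewrite /ab_conj; set h := repr (\pi g); set y := repr _.
have Nn : g^-1 * h \in (N : set G).
  by rewrite inE; apply/quotgP; rewrite reprK.
pose n : subgrp N := Sub (g^-1 * h) Nn.
have -> : subgrp_conj h y = subgrp_conj g y ^ n.
  apply: val_inj; rewrite gmulfJ /= -conjgM.
  by rewrite mulVKg.
transitivity (ab_class (subgrp_conj g y)).
  apply/quotgP; apply: generated_sub.
  exists n, (subgrp_conj g y); split=> //.
  by rewrite commgEl !conjgE !invgM invgK !mulgA.
apply/quotgP; rewrite -gmulfV -gmulfM.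
by apply: (derived_map (subgrp_conj g) (n := 1)); exact: quotg_reprP.
Qed.

(* The action of Z[G/N] on N/[N,N]. Only the additive group of the group ring
   enters the notion of torsion element, so Z[G/N] is represented by the free
   abelian group {freeg G/N / int}. *)
Definition ab_act (m : abelianization (subgrp N)) (c : {freeg (quotg N) / int}) :
    abelianization (subgrp N) :=
  (\sum_(q <- dom c) ab_conj m q *~ coeff q c)%R.

Definition ab_torsion : set (abelianization (subgrp N)) :=
  [set m | exists c : {freeg (quotg N) / int}, c <> 0%R /\ ab_act m c = 0%R].

Definition torsion_free_step : set G :=
  [set x | exists2 y : subgrp N, val y = x & ab_torsion (ab_class y)].

End Step.

(* Each term is a normal subgroup of G since the torsion elements form a
   submodule, so [normal_closureN] does not change it
   (see [normal_closure_id]): it only packs the set as a [normal_subgroup]. *)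
Fixpoint tf_derived n : set G :=
  if n is m.+1 then torsion_free_step (normal_closureN (tf_derived m))
  else setT.

Definition tf_derivedN n := normal_closureN (tf_derived n).

End TorsionFreeDerivedSeries.

(* Homology at C1 of C2 --d2--> C1 --d1--> C0: the classes of the cycles modulo
   those which are boundaries. *)
Section Homology.
Context (C2 C1 C0 : zmodType) (d2 : {additive C2 -> C1})
  (d1 : {additive C1 -> C0}).
Local Open Scope ring_scope.

Definition is_cycle : {pred C1} := [pred x | d1 x == 0].

Lemma is_cycle_zmod : zmod_closed is_cycle.
Proof.
split=> [|x y]; rewrite !inE ?raddf0 // => /eqP dx /eqP dy.
by rewrite raddfB dx dy subr0.
Qed.

HB.instance Definition _ := GRing.isZmodClosed.Build C1 is_cycle is_cycle_zmod.

Definition cycleT := {x : C1 | x \in is_cycle}.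
HB.instance Definition _ := SubChoice.on cycleT.
HB.instance Definition _ := [SubChoice_isSubZmodule of cycleT by <:].

Definition is_boundary : {pred cycleT} :=
  [pred z | `[< exists c, val z = d2 c >]].

Lemma is_boundary_zmod : zmod_closed is_boundary.
Proof.
split=> [|x y]; rewrite !inE.
  by exists 0; rewrite !raddf0.
by move=> [a xa] [b yb]; exists (a - b); rewrite !raddfB /= xa yb.
Qed.

HB.instance Definition _ :=
  GRing.isZmodClosed.Build cycleT is_boundary is_boundary_zmod.

Definition homology : zmodType := Quotient.quot is_boundary.

Definition homology_class (z : cycleT) : homology := \pi z.

End Homology.

Arguments is_boundary {C2 C1 C0} d2 d1 _.

Section HomologyMap.
Context (C2 C1 C0 E2 E1 E0 : zmodType).
Context (d2 : {additive C2 -> C1}) (d1 : {additive C1 -> C0}).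
Context (e2 : {additive E2 -> E1}) (e1 : {additive E1 -> E0}).
Context (f2 : {additive C2 -> E2}) (f1 : {additive C1 -> E1}).
Context (f0 : {additive C0 -> E0}).
Hypothesis comm2 : forall c, f1 (d2 c) = e2 (f2 c).
Hypothesis comm1 : forall c, f0 (d1 c) = e1 (f1 c).

Lemma cycle_map_in (z : cycleT d1) : f1 (val z) \in is_cycle e1.
Proof. by rewrite inE -comm1 (eqP (valP z)) raddf0. Qed.

Definition cycle_map (z : cycleT d1) : cycleT e1 :=
  Sub (f1 (val z)) (cycle_map_in z).

Definition homology_map (h : homology d2 d1) : homology e2 e1 :=
  homology_class e2 (cycle_map (repr h)).

Lemma homology_mapE (z : cycleT d1) :
  homology_map (homology_class d2 z) = homology_class e2 (cycle_map z).
Proof.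
apply/eqP; rewrite /homology_map /homology_class -Quotient.idealrBE !inE.
have : (repr (homology_class d2 z) - z)%R \in is_boundary d2 d1.
  by rewrite Quotient.idealrBE reprK.
rewrite !inE => -[c zc]; exists (f2 c).
by rewrite -comm2 -zc !raddfB.
Qed.

End HomologyMap.

Section BarComplex.
Local Open Scope ring_scope.

(* Faces of [g_1|...|g_n]: omit g_1 (i = 0), multiply g_i and g_(i+1)
   (0 < i < n), omit g_n (i = n). *)
Fixpoint bar_face (G : groupType) (i : nat) (s : seq G) : seq G :=
  match s, i with
  | [::], _ => [::]
  | _ :: s', 0%N => s'
  | x :: s', i'.+1 =>
    if s' is y :: s'' then
      if i' is 0%N then (x * y)%g :: s'' else x :: bar_face i' s'
    else [::]
  end.

Lemma size_bar_face (G : groupType) i (s : seq G) :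
  size (bar_face i s) = (size s).-1.
Proof.
elim: s i => [|x s IHs] [|i] //=.
by case: s IHs => [|y s] IHs //; case: i => [|i] //; rewrite /= (IHs i.+1).
Qed.

Lemma bar_face_map (G K : groupType) (phi : {ghom G -> K}) i s :
  bar_face i (map phi s) = map phi (bar_face i s).
Proof.
elim: s i => [|x s IHs] [|i] //=.
case: s IHs => [|y s] IHs //; case: i => [|i] //=; first by rewrite gmulfM.
by congr (_ :: _); exact: (IHs i.+1).
Qed.

Lemma freegZU (R : nzRingType) (X : choiceType) (k : R) (x : X) :
  k *: (<< x >> : {freeg X / R}) = << k *g x >>.
Proof.
by apply/eqP/freeg_eqP => y; rewrite coeffZ !coeffU mul1r.
Qed.

Section Complex.
Context (G : groupType).

Lemma bar_face_tupleP n i (t : n.+1.-tuple G) : size (bar_face i t) == n.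
Proof. by rewrite size_bar_face size_tuple. Qed.

Definition bar_face_tuple n i (t : n.+1.-tuple G) : n.-tuple G :=
  Tuple (bar_face_tupleP i t).

Definition bar_chain n : lmodType rat := {freeg (n.-tuple G) / rat}.

Definition bar_boundary n : bar_chain n -> bar_chain n.-1 :=
  match n return bar_chain n -> bar_chain n.-1 with
  | 0%N => fun=> 0
  | m.+1 => fglift (fun t : m.+1.-tuple G =>
      (\sum_(i < m.+2) (-1) ^+ i *: << bar_face_tuple i t >> : bar_chain m))
  end.

Lemma bar_boundary_additive n : zmod_morphism (@bar_boundary n).
Proof.
case: n => [|n] x y; first by rewrite subr0.
exact: lift_is_additive.
Qed.

Lemma bar_boundaryU n k (t : n.+1.-tuple G) :
  bar_boundary (<< k *g t >> : bar_chain n.+1) =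
  \sum_(i < n.+2) (<< k * (-1) ^+ i *g bar_face_tuple i t >> : bar_chain n).
Proof.
rewrite /bar_boundary liftU scaler_sumr; apply: eq_bigr => i _.
by rewrite scalerA freegZU.
Qed.

HB.instance Definition _ n := GRing.isZmodMorphism.Build
  (bar_chain n) (bar_chain n.-1) (@bar_boundary n) (@bar_boundary_additive n).

(* H_n(G; Q) = H_n(K(G,1); Q), computed by the bar complex with trivial rational
   coefficients. *)
Definition rat_homology n := homology (@bar_boundary n.+1) (@bar_boundary n).

End Complex.

Section Map.
Context (G K : groupType) (phi : {ghom G -> K}).

Definition bar_map n : bar_chain G n -> bar_chain K n :=
  fglift (fun t : n.-tuple G => (<< map_tuple phi t >> : bar_chain K n)).

Lemma bar_map_additive n : zmod_morphism (@bar_map n).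
Proof. exact: lift_is_additive. Qed.

Lemma bar_mapU n k (t : n.-tuple G) :
  bar_map (<< k *g t >> : bar_chain G n) =
  (<< k *g map_tuple phi t >> : bar_chain K n).
Proof. by rewrite /bar_map liftU freegZU. Qed.

HB.instance Definition _ n := GRing.isZmodMorphism.Build
  (bar_chain G n) (bar_chain K n) (@bar_map n) (@bar_map_additive n).

Lemma bar_map_boundary n (c : bar_chain G n) :
  bar_map (bar_boundary c) = bar_boundary (bar_map c).
Proof.
case: n c => [|n] c; first exact: (raddf0 (@bar_map 0)).
have onU k (t : n.+1.-tuple G) :
    bar_map (bar_boundary (<< k *g t >> : bar_chain G n.+1)) =
    bar_boundary (bar_map (<< k *g t >> : bar_chain G n.+1)).
  rewrite bar_mapU !bar_boundaryU (raddf_sum (@bar_map n)).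
  apply: eq_bigr => i _; rewrite [LHS]bar_mapU; congr [freeg [:: (_, _)]].
  by apply: val_inj; rewrite /= bar_face_map.
elim/freeg_ind_dom0: c => [|k t c _ _ IHc].
  rewrite (raddf0 (@bar_boundary G n.+1)) (raddf0 (@bar_map n)).
  by rewrite (raddf0 (@bar_map n.+1)) (raddf0 (@bar_boundary K n.+1)).
rewrite (raddfD (@bar_boundary G n.+1)) (raddfD (@bar_map n)).
rewrite (raddfD (@bar_map n.+1)) (raddfD (@bar_boundary K n.+1)).
exact: (congr2 +%R (onU k t) IHc).
Qed.

Definition rat_homology_map n : rat_homology G n -> rat_homology K n :=
  @homology_map _ _ _ _ _ _ (@bar_boundary G n.+1) (@bar_boundary G n)
    (@bar_boundary K n.+1) (@bar_boundary K n) (@bar_map n) (@bar_map n.-1)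
    (@bar_map_boundary n).

End Map.

End BarComplex.

Arguments rat_homology_map {G K} phi n h.

(* F is free on the family i, by the universal property. *)
Definition free_on (X : Type) (F : groupType) (i : X -> F) :=
  forall (H : groupType) (g : X -> H),
    exists2 f : {ghom F -> H}, forall x, f (i x) = g x &
      forall f' : {ghom F -> H},
        (forall x, f' (i x) = g x) -> f' =1 f.

Definition is_free (F : groupType) :=
  exists (X : Type) (i : X -> F), free_on i.

Definition finitely_related (B : groupType) :=
  exists (E : groupType) (p : {ghom E -> B}) (R : seq E),
    [/\ is_free E, forall b, exists e, p e = b &
        forall e, p e = 1 <-> normal_closure [set r | r \in R] e].

Section DerivedQuotients.
Context (G K : groupType) (phi : {ghom G -> K}) (n : nat).

Definition derived_quot_map (a : quotg (derived G n)) : quotg (derived K n) :=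
  \pi_(quotg (derived K n)) (phi (repr a)).

Lemma derived_quot_mapE x :
  derived_quot_map (\pi x) = \pi_(quotg (derived K n)) (phi x).
Proof.
apply/quotgP; rewrite -gmulfV -gmulfM.
exact/derived_map/quotg_reprP.
Qed.

Lemma derived_quot_mapM :
  {morph derived_quot_map : a b / a * b >-> a * b}.
Proof.
move=> a b; rewrite -[a]reprK -[b]reprK -gmulfM !derived_quot_mapE.
by rewrite gmulfM [LHS]gmulfM.
Qed.

HB.instance Definition _ := isMultiplicative.Build
  (quotg (derived G n)) (quotg (derived K n)) derived_quot_map derived_quot_mapM.

Lemma derived_quot_map1 : derived_quot_map 1 = 1.
Proof.
by rewrite -(pi_quotg1 (derived G n)) derived_quot_mapE gmulf1 pi_quotg1.
Qed.

HB.instance Definition _ := Multiplicative_isUMagmaMorphism.Build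
  (quotg (derived G n)) (quotg (derived K n)) derived_quot_map derived_quot_map1.

End DerivedQuotients.

Arguments derived_quot_map {G K} phi n a.

Definition subgrp_incl (G : groupType) (N : normal_subgroup G) :
  {ghom subgrp N -> G} := val.

(* H_2(B; Q) is spanned by N-surfaces. *)
Definition H2_spanned_by (B : groupType) (N : normal_subgroup B) :=
  forall y : rat_homology B 2,
    exists x, rat_homology_map (subgrp_incl N) 2 x = y.

(* Main.v *)
Require Import Defs.
From mathcomp Require Import all_boot all_order all_algebra.
From HB Require Import structures.
From mathcomp Require Import ring lra zify.
From mathcomp Require Import boolp classical_sets.
From mathcomp.multinomials Require Import freeg.

(* Put L_m for the m-th term of the torsion-free derived series of B and
   G = B/L_m; we show by induction that phi x in L_(m+1) forces x in F^(m+1).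
   Fox calculus attaches to a free group mapping to G a crossed homomorphism D
   into a free right Z[G]-module, and Magnus's theorem says that D vanishes on
   an element of the kernel only if it lies in the commutator subgroup of the
   kernel.  Present B = <E | r_1, ..., r_s> and lift phi to w : F -> E.
   If phi x is torsion modulo L_m, killed by c <> 0, then D(w x).c is a
   combination of the D(r_k), and the chain rule expresses D(w x) through the
   D(w z_i), so it suffices that the D(w z_i) are linearly independent over
   Q[G] modulo the D(r_k).  After augmentation to Q this independence is the
   injectivity on H_1.  It lifts to Q[G] because G is poly-torsion-free-abelian:
   - augmentation-injective maps of free modules are injective (Strebel);
   - Q[G] has no zero divisors, and a map from a free module of larger finite
     rank to one of smaller rank has a kernel (G is amenable);
   - every Q-relation between the augmentations of the D(r_k) lifts to a
     Q[G]-relation between the D(r_k) themselves: by Hopf's formula this is what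
     the spanning of H_2(B; Q) by surfaces in L_m provides. *)

Set Implicit Arguments.
Unset Strict Implicit.
Unset Printing Implicit Defensive.

Import Order.TTheory GRing.Theory Num.Theory.

Local Open Scope classical_set_scope.
Local Open Scope quotient_scope.
Local Open Scope ring_scope.

(** * Linear maps out of free modules *)

Section FreegLinear.
Context (R : nzRingType) (K : choiceType).
Implicit Types (u v : {freeg K / R}) (k : R) (x : K).

(** The ordinary derived series would not carry the induction: B/B^(m) may have torsion, and then
    its group ring has zero divisors. As B^(m) lies in L_m, bounding the preimage of L_m by F^(m)
    proves more than is asked. Together with phi(F^(m)) in L_m, the bound also makes F^(m) the exact
    kernel of F -> G, so that Magnus's theorem returns membership in F^(m+1). The obstacle is that
    the D(r_k) may become dependent after augmentation, so Strebel's theorem cannot be applied to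
    them and the D(w z_i) together. Finiteness of the set of relators turns this into a dimension
    count in Q[G]^s: the lifted relations account for exactly the directions that the augmentation
    loses, and a complement of them can safely be joined to the D(w z_i). *)

Lemma freeg_ind_add (P : {freeg K / R} -> Prop) :
    P 0 -> (forall k x, P << k *g x >>) ->
    (forall u v, P u -> P v -> P (u + v)) -> forall v, P v.
Proof.
by move=> P0 PU PD; elim/freeg_ind_dom0=> // k x v _ _ Pv; apply: PD.
Qed.

Lemma freeg_ext u v : (forall x, coeff x u = coeff x v) -> u = v.
Proof. by move=> e; apply/eqP/freeg_eqP. Qed.

HB.instance Definition _ (M : lmodType R) (f : K -> M) :=
  GRing.isZmodMorphism.Build {freeg K / R} M (fglift f) (lift_is_additive f).

Lemma fgliftZ (M : lmodType R) (f : K -> M) k u :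
  fglift f (k *: u) = k *: fglift f u.
Proof.
elim/freeg_ind_add: u => [|l x|u v IHu IHv]; first by rewrite !(scaler0, raddf0).
  rewrite liftU scalerA -liftU; congr fglift.
  by apply: freeg_ext => y; rewrite coeffZ !coeffU mulrA.
by rewrite scalerDr !raddfD /= IHu IHv.
Qed.

HB.instance Definition _ (M : lmodType R) (f : K -> M) :=
  GRing.isScalable.Build R {freeg K / R} M *:%R (fglift f) (@fgliftZ M f).

Lemma fgliftU1 (M : lmodType R) (f : K -> M) x : fglift f << x >> = f x.
Proof. by rewrite liftU scale1r. Qed.

Lemma eq_fglift (M : lmodType R) (f g : K -> M) :
  (forall x, f x = g x) -> forall u, fglift f u = fglift g u.
Proof.
move=> fg; elim/freeg_ind_add=> [|k x|u v IHu IHv]; rewrite ?raddf0 //.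
  by rewrite !liftU fg.
by rewrite !raddfD /= IHu IHv.
Qed.

Lemma fglift_comp (M M' : lmodType R) (f : K -> M) (g : {linear M -> M'}) u :
  g (fglift f u) = fglift (g \o f) u.
Proof.
elim/freeg_ind_add: u => [|k x|u v IHu IHv]; rewrite ?raddf0 //.
  by rewrite !liftU linearZ.
by rewrite !raddfD /= IHu IHv.
Qed.

Lemma fgliftE (M : lmodType R) (f : K -> M) u :
  fglift f u = \sum_(x <- dom u) coeff x u *: f x.
Proof.
rewrite -{1}[u]freeg_sumE raddf_sum; apply: eq_bigr => x _ /=.
by rewrite liftU.
Qed.

Lemma freegUZ k x : << k *g x >> = k *: << x >> :> {freeg K / R}.
Proof. by apply: freeg_ext => y; rewrite coeffZ !coeffU mul1r. Qed.

Lemma fglift_id u : fglift (fun x => << x >>) u = u.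
Proof.
elim/freeg_ind_add: u => [|k x|u v IHu IHv]; rewrite ?raddf0 //.
  by rewrite liftU -freegUZ.
by rewrite raddfD /= IHu IHv.
Qed.

Lemma fglift_sum (M : lmodType R) n (F : 'I_n -> K -> M) u :
  fglift (fun x => \sum_(i < n) F i x) u = \sum_(i < n) fglift (F i) u.
Proof.
elim/freeg_ind_add: u => [|k x|u v IHu IHv].
- by rewrite raddf0 big1 // => i _; rewrite raddf0.
- by rewrite liftU scaler_sumr; apply: eq_bigr => i _; rewrite liftU.
- by rewrite raddfD /= IHu IHv -big_split; apply: eq_bigr => i _; rewrite raddfD.
Qed.

Lemma fglift_add (M : lmodType R) (f g : K -> M) u :
  fglift (fun x => f x + g x) u = fglift f u + fglift g u.
Proof.
elim/freeg_ind_add: u => [|l x|u v IHu IHv]; first by rewrite !raddf0 addr0.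
  by rewrite !liftU scalerDr.
by rewrite !raddfD /= IHu IHv addrACA.
Qed.

End FreegLinear.

Section FreegLinearCom.
Context (R : comNzRingType) (K : choiceType).

Lemma fglift_scale (M : lmodType R) k (f : K -> M) u :
  fglift (fun x => k *: f x) u = k *: fglift f u.
Proof.
elim/freeg_ind_add: u => [|l x|u v IHu IHv]; first by rewrite !raddf0.
  by rewrite !liftU !scalerA mulrC.
by rewrite !raddfD /= IHu IHv.
Qed.

End FreegLinearCom.

Section PushForward.
Context (R : nzRingType).

Definition push (K L : choiceType) (f : K -> L) : {freeg K / R} -> {freeg L / R} :=
  fglift (fun x => << f x >>).

HB.instance Definition _ K L f := GRing.Linear.on (@push K L f).

Lemma pushU (K L : choiceType) (f : K -> L) k x :
  push f << k *g x >> = << k *g f x >>.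
Proof. by rewrite /push liftU -freegUZ. Qed.

Lemma push_id (K : choiceType) (u : {freeg K / R}) : push id u = u.
Proof. exact: fglift_id. Qed.

Lemma fglift_push (K L : choiceType) (M : lmodType R) (f : K -> L) (g : L -> M) u :
  fglift g (push f u) = fglift (g \o f) u.
Proof.
by rewrite [LHS]fglift_comp; apply: eq_fglift => x /=; rewrite fgliftU1.
Qed.

Lemma push_comp (K L M : choiceType) (f : K -> L) (g : L -> M) u :
  push g (push f u) = push (g \o f) u.
Proof. exact: fglift_push. Qed.

Lemma eq_push (K L : choiceType) (f g : K -> L) u : f =1 g -> push f u = push g u.
Proof. by move=> fg; apply: eq_fglift => x; rewrite fg. Qed.

Lemma coeff_push (K L : choiceType) (f : K -> L) u y :
  coeff y (push f u) = \sum_(x <- dom u | f x == y) coeff x u.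
Proof.
rewrite /push fgliftE raddf_sum [RHS]big_mkcond; apply: eq_bigr => x _ /=.
by rewrite coeffZ coeffU mul1r; case: eqP => _; rewrite ?mulr1 ?mulr0.
Qed.

Lemma coeff_push_inj (K L : choiceType) (f : K -> L) u x :
  injective f -> coeff (f x) (push f u) = coeff x u.
Proof.
move=> fI; rewrite coeff_push; under eq_bigl do rewrite (inj_eq fI).
have [xu|xu] := boolP (x \in dom u).
  rewrite big_mkcond (bigD1_seq x) ?uniq_dom //= eqxx big1 ?addr0 // => y yx.
  by rewrite (negPf yx).
rewrite coeff_outdom // big_seq_cond big1 // => y /andP[yu /eqP yx].
by rewrite yx (negPf xu) in yu.
Qed.

Lemma push_inj (K L : choiceType) (f : K -> L) : injective f -> injective (push f).
Proof.
by move=> fI u v uv; apply: freeg_ext => x; rewrite -!(coeff_push_inj _ _ fI) uv.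
Qed.

Section Sum.
Context (K L X : choiceType) (f : K -> X) (g : L -> X).

Lemma push_cover (v : {freeg X / R}) :
    (forall x, (exists k, x = f k) \/ (exists l, x = g l)) ->
  exists a b, v = push f a + push g b.
Proof.
move=> fg; elim/freeg_ind_add: v => [|k x|u v [a [b ->]] [c [d ->]]].
- by exists 0, 0; rewrite !raddf0 addr0.
- have [[y ->]|[y ->]] := fg x; [exists << k *g y >>, 0|exists 0, << k *g y >>].
    by rewrite pushU raddf0 addr0.
  by rewrite pushU raddf0 add0r.
by exists (a + c), (b + d); rewrite !raddfD /= addrACA.
Qed.

Lemma push_disjoint a b : injective f -> injective g -> (forall k l, f k <> g l) ->
  push f a + push g b = 0 -> a = 0 /\ b = 0.
Proof.
move=> fI gI fg e; split; apply: freeg_ext => x; rewrite coeff0.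
  have := congr1 (coeff (f x)) e; rewrite coeff0 coeffD coeff_push_inj //.
  rewrite coeff_push big1 ?addr0 // => l /eqP e'; by case: (fg x l).
have := congr1 (coeff (g x)) e; rewrite coeff0 coeffD [X in _ + X]coeff_push_inj //.
by rewrite coeff_push big1 ?add0r // => k /eqP e'; case: (fg k x).
Qed.

End Sum.

End PushForward.

(** * Free right modules over a group ring *)

Section FreeModule.
Context (R : nzRingType) (G : groupType).
Implicit Types (I J : choiceType) (g h : G) (c d : {freeg G / R}).

(** The free right R[G]-module on I is encoded as the free R-module on [I * G], the pair (i, g)
    standing for the basis vector i times g. Being R[G]-linear then means being R-linear and
    commuting with every [ract g]. *)
Definition ract {I} g : {freeg (I * G) / R} -> {freeg (I * G) / R} :=
  push (fun y => (y.1, y.2 * g)%g).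

HB.instance Definition _ I g := GRing.Linear.on (@ract I g).

(** The R[G]-linear map of free modules that sends the basis vector i to [m i]. *)
Definition elift I J (m : I -> {freeg (J * G) / R}) :
    {freeg (I * G) / R} -> {freeg (J * G) / R} :=
  fglift (fun y => ract y.2 (m y.1)).

HB.instance Definition _ I J m := GRing.Linear.on (@elift I J m).

(** Base change of the free module along the augmentation R[G] -> R. *)
Definition aug {I} : {freeg (I * G) / R} -> {freeg I / R} := push fst.

HB.instance Definition _ (I : choiceType) := GRing.Linear.on (@aug I).

Definition act I (v : {freeg (I * G) / R}) : {freeg G / R} -> {freeg (I * G) / R} :=
  fglift (fun g => ract g v).

HB.instance Definition _ I v := GRing.Linear.on (@act I v).

Lemma ractU I g i h k : ract g << k *g (i, h) >> = << k *g (i, h * g)%g >> :> {freeg (I * G) / R}.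
Proof. exact: pushU. Qed.

Lemma ract1 I (v : {freeg (I * G) / R}) : ract 1%g v = v.
Proof.
by rewrite -[RHS]push_id; apply: eq_push => -[i h] /=; rewrite mulg1.
Qed.

Lemma ractM I g h (v : {freeg (I * G) / R}) : ract g (ract h v) = ract (h * g)%g v.
Proof. by rewrite /ract push_comp; apply: eq_push => -[i k] /=; rewrite mulgA. Qed.

Lemma eliftU I J (m : I -> {freeg (J * G) / R}) i g : elift m << (i, g) >> = ract g (m i).
Proof. exact: fgliftU1. Qed.

Lemma elift_ract I J (m : I -> {freeg (J * G) / R}) g v :
  elift m (ract g v) = ract g (elift m v).
Proof.
rewrite /elift fglift_push fglift_comp; apply: eq_fglift => -[i h] /=.
by rewrite ractM.
Qed.

Lemma elift_act I J (m : I -> {freeg (J * G) / R}) v c :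
  elift m (act v c) = act (elift m v) c.
Proof.
rewrite [LHS]fglift_comp; apply: eq_fglift => g /=; exact: elift_ract.
Qed.

Lemma elift_comp I J (K : choiceType) (m : J -> {freeg (K * G) / R})
    (l : I -> {freeg (J * G) / R}) v :
  elift m (elift l v) = elift (elift m \o l) v.
Proof. by rewrite [LHS]fglift_comp; apply: eq_fglift => -[i g]; exact: elift_ract. Qed.

Lemma elift_push (I I' J : choiceType) (f : I -> I') (m : I' -> {freeg (J * G) / R}) v :
  elift m (push (fun y => (f y.1, y.2)) v) = elift (m \o f) v.
Proof. exact: fglift_push. Qed.

Lemma aug_ract I g (v : {freeg (I * G) / R}) : aug (ract g v) = aug v.
Proof. exact: push_comp. Qed.

Lemma aug_fglift I (K : choiceType) (f : K -> {freeg (I * G) / R}) (u : {freeg K / R}) :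
  aug (fglift f u) = fglift (aug \o f) u.
Proof. exact: fglift_comp. Qed.

Lemma aug_elift I J (m : I -> {freeg (J * G) / R}) v :
  aug (elift m v) = fglift (aug \o m) (aug v).
Proof.
rewrite [LHS]fglift_comp [RHS]fglift_push; apply: eq_fglift => -[i g].
exact: aug_ract.
Qed.

Lemma actDl I (u v : {freeg (I * G) / R}) c : act (u + v) c = act u c + act v c.
Proof. by rewrite -[RHS]fglift_add; apply: eq_fglift => g; rewrite raddfD. Qed.

Lemma act0l I c : act (0 : {freeg (I * G) / R}) c = 0.
Proof. by apply: (@addrI _ (act 0 c)); rewrite -actDl !addr0. Qed.

Lemma actU1 I (v : {freeg (I * G) / R}) g : act v << g >> = ract g v.
Proof. exact: fgliftU1. Qed.

Lemma coeff_ract I (v : {freeg (I * G) / R}) i g h :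
  coeff (i, h) (ract g v) = coeff (i, h * g^-1)%g v.
Proof.
rewrite -{1}[h](mulgVK g) -[LHS]/(coeff ((fun y : I * G => (y.1, y.2 * g)%g) (i, h * g^-1)%g) _).
by rewrite coeff_push_inj // => -[j k] [j' k'] /= [-> /mulIg ->].
Qed.

Lemma coeff_act I (v : {freeg (I * G) / R}) c i h :
  coeff (i, h) (act v c) = \sum_(g <- dom c) coeff g c * coeff (i, h * g^-1)%g v.
Proof.
rewrite /act fgliftE raddf_sum; apply: eq_bigr => g _ /=.
by rewrite coeffZ coeff_ract.
Qed.

End FreeModule.

Arguments ract {R G I} g _.
Arguments aug {R G I} _.

(** * Rational characters of torsion-free abelian groups *)

Section RatCharacter.
Context (V : zmodType).
Implicit Types (R : set (V * rat)) (x : V) (c : rat) (k : int).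

Let closedB R := forall p q, R p -> R q -> R (p - q).
Let functional R := forall c, R (0, c) -> c = 0.

Let closed0 R p : closedB R -> R p -> R 0.
Proof. by move=> RB Rp; rewrite -(subrr p); exact: RB. Qed.

Let closedN R p : closedB R -> R p -> R (- p).
Proof. by move=> RB Rp; rewrite -sub0r; apply: (RB) => //; exact: (closed0 RB Rp). Qed.

Let closedD R p q : closedB R -> R p -> R q -> R (p + q).
Proof. by move=> RB Rp Rq; rewrite -[q]opprK; apply: (RB) => //; exact: closedN. Qed.

Let closedMz R p k : closedB R -> R p -> R (p *~ k).
Proof.
move=> RB Rp; have RMn n : R (p *+ n).
  by elim: n => [|n IHn]; [exact: (closed0 RB Rp) | rewrite mulrS; exact: (closedD RB)].
case: k => n; first exact: RMn.
by rewrite NegzE mulrNz; exact: (closedN RB (RMn _)).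
Qed.

Let pairMz x c k : (x, c) *~ k = (x *~ k, c *~ k) :> V * rat.
Proof.
have pairMn n : (x, c) *+ n = (x *+ n, c *+ n) :> V * rat.
  by elim: n => [|n IHn] //; rewrite !mulrS IHn.
by case: k => n; rewrite ?NegzE ?mulrNz -!pmulrn pairMn.
Qed.

Let pairB x y (c d : rat) : (x, c) - (y, d) = (x - y, c - d) :> V * rat.
Proof. by []. Qed.

Let adjoin R x c : set (V * rat) :=
  [set p | exists r k, R r /\ p = r + (x, c) *~ k].

Let adjoin_good R x c : closedB R -> functional R ->
    (forall k q, R (x *~ k, q) -> q = c *~ k) ->
  closedB (adjoin R x c) /\ functional (adjoin R x c).
Proof.
move=> RB Rf Rx; split.
  move=> _ _ [r [k [Rr ->]]] [s [l [Rs ->]]]; exists (r - s), (k - l).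
  by split; [exact: RB | rewrite mulrzBr opprD addrACA].
move=> d [[y q] [k [Rr]]]; rewrite pairMz => -[e1 e2].
have xk : x *~ k = - y by apply/eqP; rewrite -addr_eq0 addrC -e1.
rewrite e2; have /Rx <- : R (x *~ k, - q) by rewrite xk; exact: (closedN RB Rr).
by rewrite subrr.
Qed.

(** Zorn's lemma on graphs of partial homomorphisms to Q that send a to 1; divisibility of Q makes a
    maximal graph total. *)
Lemma rat_character a : (forall x n, x *+ n.+1 = 0 -> x = 0) -> a <> 0 ->
  exists2 chi : V -> rat, {morph chi : x y / x + y} & chi a <> 0.
Proof.
move=> tf a0.
have tfz x k : x *~ k = 0 -> x <> 0 -> k = 0.
  case: k => [[|n]|n] //; rewrite ?NegzE ?mulrNz => xk x0; case: x0; apply: (tf _ n).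
    exact: xk.
  by move/eqP: xk; rewrite oppr_eq0 => /eqP.
(* The empty chain has empty union, so the empty relation has to satisfy [P]; hence (a, 1) is
   required only in a non-empty graph. *)
pose P R := [/\ closedB R, functional R & (exists p, R p) -> R (a, 1)].
have [R [[RB Rf Ra] Rmax]] : exists R, P R /\ forall S, R `<` S -> ~ P S.
  apply: Zorn_bigcup => F FP Ftot; split.
  - move=> p q [S FS Sp] [T FT Tq].
    have [ST|TS] := Ftot _ _ FS FT; [exists T|exists S] => //.
      by have [TB _ _] := FP _ FT; apply: TB => //; exact: ST.
    by have [SB _ _] := FP _ FS; apply: SB => //; exact: TS.
  - by move=> c [S FS Sc]; have [_ Sf _] := FP _ FS; exact: Sf.
  - move=> [p [S FS Sp]]; exists S => //.
    by have [_ _ Sa] := FP _ FS; apply: Sa; exists p.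
have extend S x c : (exists p, S p) -> closedB S -> functional S ->
    (forall k q, S (x *~ k, q) -> q = c *~ k) ->
    [/\ closedB (adjoin S x c), functional (adjoin S x c),
      S `<=` adjoin S x c & adjoin S x c (x, c)].
  move=> [p Sp] SB Sf Sx; have [AB Af] := adjoin_good SB Sf Sx; split=> //.
    by move=> q Sq; exists q, 0; rewrite addr0.
  by exists 0, 1; split; [exact: (closed0 SB Sp)|rewrite add0r mulr1z].
have Rne : exists p, R p.
  apply: contrapT => Re; have := Rmax (adjoin [set 0] a 1).
  have [||||AB Af _ Aa] := @extend [set 0] a 1.
  - by exists 0.
  - by move=> p q -> ->; rewrite subr0.
  - by move=> c [].
  - move=> k q [ak ->]; have -> : k = 0 by apply: tfz ak a0.
    by rewrite mulr0z.
  move=> /(_ _) A0; apply: A0; last by split.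
  split=> [p Rp|]; first by case: Re; exists p.
  by move=> /(_ _ Aa) Rp; apply: Re; exists (a, 1).
have Rtot x : exists q, R (x, q).
  apply: contrapT => Rx.
  (* If some nonzero multiple kx already has a value q, then x must go to q / k, and comparing
     values at jkx shows that this fits all other multiples. Otherwise 0 will do. *)
  have [c Rc] : exists c, forall k q, R (x *~ k, q) -> q = c *~ k.
    have [[k [q [k0 Rk]]]|nk] := pselect (exists k q, k <> 0 /\ R (x *~ k, q)).
      exists (q / k%:~R) => j r Rj.
      have := closedMz j RB Rk; have := closedMz k RB Rj; rewrite !pairMz.
      rewrite -!mulrzA [k * j]mulrC => R1 R2; have := RB _ _ R1 R2.
      rewrite pairB subrr => /Rf /eqP.
      rewrite subr_eq0 => /eqP; rewrite -[r *~ k]mulrzr -[q *~ j]mulrzr -[q / _ *~ j]mulrzr.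
      have k0' : k%:~R != 0 :> rat by rewrite intr_eq0; apply/eqP.
      by move=> e; rewrite mulrAC -e mulfK.
    exists 0 => k q Rk; have k0 : k = 0.
      by apply: contrapT => k0; apply: nk; exists k, q.
    by rewrite mul0rz; apply: Rf; rewrite k0 mulr0z in Rk.
  have [AB Af SA Ax] := extend R x c Rne RB Rf Rc.
  apply: (Rmax (adjoin R x c)); last first.
    by split=> // _; apply: SA; exact: Ra.
  by split=> // /(_ _ Ax) Rxc; apply: Rx; exists c.
have [chi chiP] := choice Rtot.
have Rfun x q r : R (x, q) -> R (x, r) -> q = r.
  move=> Rq Rr; have := RB _ _ Rq Rr.
  by rewrite pairB subrr => /Rf /eqP; rewrite subr_eq0 => /eqP.
exists chi; first by move=> x y; apply: (Rfun (x + y)) => //; exact: (closedD RB (chiP x) (chiP y)).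
by rewrite (Rfun _ _ _ (chiP a) (Ra Rne)).
Qed.

End RatCharacter.

(** * Abelianization of a normal subgroup, computed on elements of the group *)

Section AbelianizedSubgroup.
Context (G : groupType) (N : normal_subgroup G).
Implicit Types (x y g : G).

Lemma ab_classM (H : groupType) (x y : H) : ab_class (x * y)%g = ab_class x + ab_class y.
Proof. exact: gmulfM. Qed.

Lemma ab_class1 (H : groupType) : ab_class (1%g : H) = 0.
Proof. exact: pi_quotg1. Qed.

Lemma ab_classV (H : groupType) (x : H) : ab_class (x^-1)%g = - ab_class x.
Proof. exact: gmulfV. Qed.

Lemma ab_class_eq0 (H : groupType) (x : H) :
  ab_class x = 0 <-> commutator_subgroup setT x.
Proof.
rewrite -(ab_class1 H); split=> [/esym/quotgP|x1]; first by rewrite invg1 mul1g.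
by apply/esym/quotgP; rewrite invg1 mul1g.
Qed.

Lemma normal1 : (N : set G) 1%g.
Proof. by have [[]] := normal_setP N. Qed.

Lemma normalM x y : (N : set G) x -> (N : set G) y -> (N : set G) (x * y)%g.
Proof. exact: subgroupM (normal_setP N).1. Qed.

Lemma normalV x : (N : set G) x -> (N : set G) (x^-1)%g.
Proof. exact: subgroupV (normal_setP N).1. Qed.

Lemma normalJ x g : (N : set G) x -> (N : set G) (x ^ g)%g.
Proof. exact: (normal_setP N).2. Qed.

Lemma normalX x n : (N : set G) x -> (N : set G) (x ^+ n)%g.
Proof.
move=> Nx; elim: n => [|n IHn]; first exact: normal1.
by rewrite expgS; exact: normalM.
Qed.

Lemma normalR x y : (N : set G) x -> (N : set G) [~ x, y]%g.
Proof. by move=> Nx; rewrite commgEl; apply: normalM; [exact: normalV | exact: normalJ]. Qed.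

Lemma commutator_sub : commutator_subgroup N `<=` N.
Proof.
apply: generated_min; first exact: (normal_setP N).1.
by move=> _ [x [y [Nx Ny ->]]]; exact: normalR.
Qed.

(** Total on G, with the class of 1 as default value outside N, so that computations take place in G
    and not in the subtype. *)
Definition ab_of x : abelianization (subgrp N) := ab_class (insubd (1%g : subgrp N) x).

Lemma val_ab_of x : (N : set G) x -> val (insubd (1%g : subgrp N) x) = x.
Proof. by move=> Nx; rewrite insubdK // inE. Qed.

Lemma ab_of_val (y : subgrp N) : ab_of (val y) = ab_class y.
Proof. by rewrite /ab_of valKd. Qed.

Lemma ab_ofM x y : (N : set G) x -> (N : set G) y -> ab_of (x * y)%g = ab_of x + ab_of y.
Proof.
move=> Nx Ny; rewrite -ab_classM; congr ab_class; apply: val_inj.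
rewrite val_ab_of; last exact: normalM.
by rewrite gmulfM /= !val_ab_of.
Qed.

Lemma ab_of1 : ab_of 1%g = 0.
Proof. by rewrite -(ab_class1 (subgrp N)) -ab_of_val; congr ab_of; rewrite gmulf1. Qed.

Lemma ab_ofV x : (N : set G) x -> ab_of (x^-1)%g = - ab_of x.
Proof.
by move=> Nx; apply/esym/addr0_eq; rewrite -ab_ofM ?mulgV ?ab_of1 //; exact: normalV.
Qed.

Lemma ab_ofX x n : (N : set G) x -> ab_of (x ^+ n)%g = ab_of x *+ n.
Proof.
move=> Nx; elim: n => [|n IHn]; first exact: ab_of1.
by rewrite expgS mulrS ab_ofM ?IHn //; exact: normalX.
Qed.

Lemma ab_ofP (m : abelianization (subgrp N)) : exists2 x, (N : set G) x & m = ab_of x.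
Proof.
exists (val (repr m)); last by rewrite ab_of_val [LHS](esym (reprK m)).
by have := valP (repr m); rewrite inE.
Qed.

Lemma ab_of_eq0 x : (N : set G) x -> (ab_of x = 0 <-> commutator_subgroup N x).
Proof.
move=> Nx; rewrite ab_class_eq0 -{2}(val_ab_of Nx); set y := insubd _ x.
split.
  apply: (generated_min (A := [set y : subgrp N | commutator_subgroup N (val y)])).
    have [C1 CF] := generated_subgroup
      [set z | exists x y, [/\ (N : set G) x, (N : set G) y & z = [~ x, y]%g]].
    split=> [|a b Ca Cb]; first by rewrite /mkset gmulf1.
    by rewrite /mkset gmulfF; exact: CF.
  move=> _ [a [b [_ _ ->]]]; rewrite /mkset gmulfR.
  apply: generated_sub; exists (val a), (val b).
  by split=> //; have := valP a; have := valP b; rewrite !inE.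
move: y => y Cy.
(* Membership in N belongs to the invariant because [insubd] respects products only on N. *)
suff : forall z, commutator_subgroup N z ->
    (N : set G) z /\ commutator_subgroup setT (insubd (1%g : subgrp N) z).
  by move=> /(_ _ Cy) [_]; rewrite valKd.
apply: (generated_min (A := [set z | _])).
  have [C1 CF] := generated_subgroup
    [set z | exists x y : subgrp N, [/\ setT x, setT y & z = [~ x, y]%g]].
  split=> [|a b [Na Ca] [Nb Cb]] /=.
    split; first exact: normal1.
    rewrite (_ : insubd _ _ = 1%g) //; apply: val_inj; rewrite val_ab_of ?gmulf1 //.
    exact: normal1.
  have Nab : (N : set G) (a / b)%g by apply: normalM => //; exact: normalV.
  split=> //; rewrite (_ : insubd _ _ = insubd 1 a / insubd 1 b)%g; first exact: CF.
  by apply: val_inj; rewrite gmulfF /= !val_ab_of.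
move=> _ [a [b [Na Nb ->]]] /=; split; first exact: normalR.
apply: generated_sub; exists (insubd 1%g a), (insubd 1%g b); split=> //.
by apply: val_inj; rewrite gmulfR /= !val_ab_of //; exact: normalR.
Qed.

Lemma ab_conj_of x g : (N : set G) x -> ab_conj (ab_of x) (\pi g) = ab_of (x ^ g)%g.
Proof.
move=> Nx; rewrite ab_conjE; congr ab_class; apply: val_inj => /=.
by rewrite !val_ab_of //; exact: normalJ.
Qed.

End AbelianizedSubgroup.

(** * Kernels and poly-torsion-free-abelian groups *)

Section Kernel.
Context (G H : groupType) (f : {ghom G -> H}).

Lemma ker_normal : is_normal [set x | f x = 1%g].
Proof.
split; [split=> [|x y] /=; first by rewrite gmulf1|move=> x g /=].
  by rewrite gmulfF => -> ->; rewrite mulgV.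
by rewrite gmulfJ => ->; rewrite conj1g.
Qed.

Definition kerN := NormalSubgroup ker_normal.

Lemma kerE x : (kerN : set G) x = (f x = 1%g). Proof. by []. Qed.

End Kernel.

(* Polytorsion-free-abelian groups: the kernel of [f] is a torsion-free abelian
   normal subgroup, so the inductive step adds one layer at the bottom. *)
Inductive ptfa : groupType -> Prop :=
| ptfa_trivial (G : groupType) : (forall x : G, x = 1%g) -> ptfa G
| ptfa_extension (G H : groupType) (f : {ghom G -> H}) :
    (forall y, exists x, f x = y) ->
    (forall x y, f x = 1%g -> f y = 1%g -> commute x y) ->
    (forall x n, f x = 1%g -> (x ^+ n.+1)%g = 1%g -> x = 1%g) ->
    ptfa H -> ptfa G.

Section GenericCharacter.
Context (G H : groupType) (f : {ghom G -> H}).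
Hypothesis f_comm : forall x y, f x = 1%g -> f y = 1%g -> commute x y.
Hypothesis f_tf : forall x n, f x = 1%g -> (x ^+ n.+1)%g = 1%g -> x = 1%g.

Definition ker_character (chi : G -> rat) :=
  forall x y, f x = 1%g -> f y = 1%g -> chi (x * y)%g = chi x + chi y.

Lemma ker_commutator x : commutator_subgroup (kerN f) x -> x = 1%g.
Proof.
apply: (generated_min (A := [set x | x = 1%g])) => [|_ [a [b [fa fb ->]]]].
  by split=> // a b -> ->; rewrite mulgV.
by apply/eqP/commgP; exact: f_comm.
Qed.

Lemma ker_character_neq0 a : f a = 1%g -> a <> 1%g ->
  exists2 chi, ker_character chi & chi a <> 0.
Proof.
move=> fa a1.
have [x n|e|chi chiD chia] := @rat_character _ (ab_of (kerN f) a).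
- have [y fy ->] := ab_ofP x; rewrite -ab_ofX // ab_of_eq0; last exact: normalX.
  by move=> /ker_commutator /(f_tf fy) ->; rewrite ab_of1.
- by apply: a1; apply: ker_commutator; apply/ab_of_eq0.
- by exists (chi \o ab_of (kerN f)) => // x y fx fy /=; rewrite ab_ofM.
Qed.

(** One character that detects all of finitely many kernel elements. It serves both to pick extremal
    elements of finite sets and to separate the elements of a finite support. *)
Lemma generic_ker_character (s : seq G) :
  exists2 chi, ker_character chi &
    forall a, a \in s -> f a = 1%g -> a <> 1%g -> chi a <> 0.
Proof.
elim: s => [|a s [chi chiM chis]]; first by exists (fun=> 0).
have [[fa a1]|na] := pselect (f a = 1%g /\ a <> 1%g); last first.
  exists chi => // b; rewrite inE => /orP[/eqP ->|/chis] // fb b1.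
  by case: na.
have [psi psiM psia] := ker_character_neq0 fa a1.
(* All but finitely many rational combinations of [chi] and [psi] work. *)
pose bad := [seq - psi b / chi b | b <- a :: s].
have [q qbad] : exists q : rat, q \notin bad.
  (* [1 + B] is larger than every element of [bad] in absolute value. *)
  pose B : rat := \sum_(r <- bad) `|r|.
  have B0 : 0 <= B by exact: sumr_ge0.
  exists (1 + B); apply/negP => qb.
  suff : `|1 + B| <= B by rewrite ger0_norm ?addr_ge0 // gerDr ler10.
  by rewrite {2}/B (big_rem _ qb) /= lerDl sumr_ge0.
exists (fun x => q * chi x + psi x).
  by move=> x y fx fy; rewrite chiM // psiM // mulrDr addrACA.
move=> b bs fb b1 qb.
have [cb0|cb0] := eqVneq (chi b) 0.
  move: bs qb; rewrite cb0 mulr0 add0r inE => /orP[/eqP ->|bs] //.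
  by case: (chis b bs fb b1).
move/negP: qbad; apply; apply/mapP; exists b => //.
by apply: (mulIf cb0); rewrite mulfVK // ; apply/eqP; rewrite -addr_eq0 qb.
Qed.

End GenericCharacter.

(** * Zero divisors in group rings *)

Section KernelCharacter.
Context (G H : groupType) (f : {ghom G -> H}) (chi : G -> rat).
Hypothesis chiM : ker_character f chi.

Lemma ker_character1 : chi 1%g = 0.
Proof. by apply: (@addrI _ (chi 1%g)); rewrite addr0 -chiM ?mulg1 ?gmulf1. Qed.

Lemma ker_characterV x : f x = 1%g -> chi (x^-1)%g = - chi x.
Proof.
move=> fx; apply/esym/addr0_eq; rewrite -chiM ?mulgV ?ker_character1 //.
by rewrite gmulfV fx invg1.
Qed.

Lemma ker_same x y : f x = f y -> f (x^-1 * y)%g = 1%g.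
Proof. by move=> e; rewrite gmulfM gmulfV e mulVg. Qed.

End KernelCharacter.

Lemma seq_arg_max (T : eqType) (s : seq T) (h : T -> rat) x0 : x0 \in s ->
  exists2 x, x \in s & forall y, y \in s -> h y <= h x.
Proof.
elim: s x0 => // a [|b s] IHs x0 _.
  by exists a => [|y]; rewrite inE // => /eqP ->.
have [x xs xmax] := IHs b (mem_head b s); case: (leP (h x) (h a)) => xa.
  exists a => [|y]; first exact: mem_head.
  by rewrite inE => /orP[/eqP -> //|/xmax yx]; exact: le_trans xa.
exists x; first by rewrite inE xs orbT.
by move=> y; rewrite inE => /orP[/eqP ->|/xmax //]; exact: ltW.
Qed.

(** A unique product in the quotient selects one fibre of S and one of T. Inside these fibres a
    generic character of the kernel is maximised on both sides; additivity forces any other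
    factorization to attain both maxima, and genericity then forces equality. *)
Lemma ptfa_unique_product (G : groupType) : ptfa G ->
  forall (S T : seq G) x0 y0, x0 \in S -> y0 \in T ->
  exists x y, [/\ x \in S, y \in T &
    forall x' y', x' \in S -> y' \in T -> (x' * y' = x * y)%g -> x' = x /\ y' = y].
Proof.
elim=> {G} [G G1|G H f _ f_comm f_tf _ IH] S T a0 b0 a0S b0T.
  exists a0, b0; split=> // x y _ _ _.
  by rewrite (G1 x) (G1 y) (G1 a0) (G1 b0).
have [_ [_ [/mapP[x0 x0S ->] /mapP[y0 y0T ->] uniq0]]] :=
  IH _ _ _ _ (map_f f a0S) (map_f f b0T).
pose S' := [seq x <- S | f x == f x0]; pose T' := [seq y <- T | f y == f y0].
have [chi chiM chi_gen] := generic_ker_character f_comm f_tf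
  ([seq (x^-1 * x')%g | x <- S, x' <- S] ++ [seq (x * x'^-1)%g | x <- T, x' <- T]).
have x0S' : x0 \in S' by rewrite mem_filter eqxx.
have y0T' : y0 \in T' by rewrite mem_filter eqxx.
have [x xS' xmax] := seq_arg_max (fun x => chi (x0^-1 * x)%g) x0S'.
have [y yT' ymax] := seq_arg_max (fun y => chi (y * y0^-1)%g) y0T'.
move: (xS') (yT'); rewrite !mem_filter => /andP[/eqP fx xS] /andP[/eqP fy yT].
exists x, y; split=> // x' y' x'S y'T e.
have [fx' fy'] : f x' = f x0 /\ f y' = f y0.
  by apply: uniq0; rewrite ?map_f // -gmulfM e gmulfM fx fy.
have kx u : f u = f x0 -> f (x0^-1 * u)%g = 1%g by move=> fu; exact: ker_same.
have ky u : f u = f y0 -> f (u * y0^-1)%g = 1%g.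
  by move=> fu; rewrite gmulfM gmulfV fu mulgV.
(* S is translated on the left and T on the right, so the product of the translates is x0^-1 (x y)
   y0^-1, which depends only on x y. *)
have e' : chi (x0^-1 * x')%g + chi (y' * y0^-1)%g = chi (x0^-1 * x)%g + chi (y * y0^-1)%g.
  rewrite -!chiM ?kx ?ky //; congr chi.
  by rewrite !mulgA -(mulgA _ x' y') e !mulgA.
have x'x : chi (x0^-1 * x')%g <= chi (x0^-1 * x)%g.
  by apply: xmax; rewrite mem_filter fx' eqxx.
have y'y : chi (y' * y0^-1)%g <= chi (y * y0^-1)%g.
  by apply: ymax; rewrite mem_filter fy' eqxx.
have ex : chi (x0^-1 * x')%g = chi (x0^-1 * x)%g by lra.
have xx' : x' = x.
  apply: (mulgI x^-1%g); rewrite mulVg; apply: contrapT => x1.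
  apply: (chi_gen (x^-1 * x')%g _ _ x1).
  - by rewrite mem_cat; apply/orP; left; apply/allpairsP; exists (x, x').
  - by apply: ker_same; rewrite fx.
  rewrite -[x'](mulVKg x0) mulgA.
  have -> : (x^-1 * x0 = (x0^-1 * x)^-1)%g by rewrite invgM invgK.
  by rewrite chiM ?kx // ?gmulfV ?kx ?invg1 // (ker_characterV chiM) ?kx // ex addNr.
by split=> //; apply: (mulgI x); rewrite -e xx'.
Qed.

(** At a unique product of the supports of c and of one nonzero coordinate of v, the coefficient of
    [act v c] is a single product of nonzero scalars. *)
Lemma ptfa_no_zero_divisor (R : idomainType) (G : groupType) (I : choiceType)
    (v : {freeg (I * G) / R}) (c : {freeg G / R}) :
  ptfa G -> act v c = 0 -> c <> 0 -> v = 0.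
Proof.
move=> Gp vc c0; apply: contrapT => v0.
have [g0 g0c] : exists g, g \in dom c.
  case E : (dom c) => [|g s]; last by exists g; rewrite mem_head.
  by case: c0; apply/eqP; rewrite -dom_eq0 E.
have [[i h0] h0v] : exists y, y \in dom v.
  case E : (dom v) => [|y s]; last by exists y; rewrite mem_head.
  by case: v0; apply/eqP; rewrite -dom_eq0 E.
pose S := [seq y.2 | y <- dom v & y.1 == i].
have h0S : h0 \in S by apply/mapP; exists (i, h0); rewrite ?mem_filter /= ?eqxx.
have [x [y [/mapP[[j x']]]]] := ptfa_unique_product Gp h0S g0c.
rewrite mem_filter /= => /andP[/eqP -> xv] -> {x j} yc uniq.
have := congr1 (coeff (i, x' * y)%g) vc; rewrite coeff_act coeff0.
rewrite (bigD1_seq y) ?uniq_dom //= mulgK big_seq_cond big1 ?addr0.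
  by move/eqP; rewrite mulf_eq0 -[_ == 0]negbK -mem_dom yc -[_ == 0]negbK -mem_dom xv.
move=> z /andP[zc zy]; rewrite [X in _ * X]coeff_outdom ?mulr0 //.
apply/negP => xz; move/eqP: zy; apply.
apply: (uniq (x' * y * z^-1)%g z _ zc _).2; last by rewrite mulgVK.
by apply/mapP; exists (i, (x' * y * z^-1)%g); rewrite ?mem_filter /= ?eqxx.
Qed.

(** * Strebel's theorem *)

(** The defining property of Strebel's class D(Q), for free modules of arbitrary rank. *)
Definition conservative (G : groupType) :=
  forall (I J : choiceType) (m : I -> {freeg (J * G) / rat}),
    (forall u, fglift (aug \o m) u = 0 -> u = 0) ->
    forall v, elift m v = 0 -> v = 0.

(* If [elift m v = 0], the moments of [v] with respect to the height are killed,
   up to lower moments, by the injective map induced over H; so all of them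
   vanish, and they determine [v] once [chi] separates the heights. *)
Section ConservativeExtension.
Context (G H : groupType) (f : {ghom G -> H}) (s : H -> G) (chi : G -> rat).
Hypothesis sK : cancel s f.
Hypothesis chiM : ker_character f chi.

Let height g := chi ((s (f g))^-1 * g)%g.

Let heightM g x : f x = 1%g -> height (g * x)%g = height g + chi x.
Proof.
move=> fx; rewrite /height gmulfM fx mulg1 mulgA chiM //.
by apply: ker_same; rewrite sK.
Qed.

(** Right multiplication by a kernel element adds its character to the height, and g is [s (f g)]
    times such an element. So left translation by z shifts all heights over one point of H by the
    same constant. *)
Let heightB z g : height (z * g)%g - height g = height (z * s (f g))%g - height (s (f g)).
Proof.
have fx : f ((s (f g))^-1 * g)%g = 1%g by apply: ker_same; rewrite sK.
have e1 : height (z * g)%g = height (z * s (f g))%g + chi ((s (f g))^-1 * g)%g.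
  by rewrite -heightM // -mulgA mulVKg.
have e2 : height g = height (s (f g)) + chi ((s (f g))^-1 * g)%g.
  by rewrite -heightM // mulVKg.
rewrite e1 e2; ring.
Qed.

Definition moment (I : choiceType) k : {freeg (I * G) / rat} -> {freeg (I * H) / rat} :=
  fglift (fun y => height y.2 ^+ k *: << (y.1, f y.2) >>).

HB.instance Definition _ (I : choiceType) k := GRing.Linear.on (@moment I k).

Let push_ker {I : choiceType} : {freeg (I * G) / rat} -> {freeg (I * H) / rat} :=
  push (fun y => (y.1, f y.2)).

Section Moments.
Context (I J : choiceType) (m : I -> {freeg (J * G) / rat}).

Let shift l (y : I * H) : {freeg (J * H) / rat} :=
  fglift (fun z : J * G => (height (z.2 * s y.2)%g - height (s y.2)) ^+ l *:
    << (z.1, f z.2 * y.2)%g >>) (m y.1).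

(** By [heightB] the height of z * g is that of g plus a shift depending on z and [f g] only; its
    k-th power is expanded by the binomial theorem. The term l = 0 is the k-th moment of v under the
    map induced over H, the others involve lower moments. *)
Let moment_elift k v :
  moment k (elift m v) =
  \sum_(l < k.+1) 'C(k, l)%:R *: fglift (shift l) (moment (k - l) v).
Proof.
elim/freeg_ind_add: v => [|a [i g]|u v IHu IHv].
- by rewrite !raddf0 big1 // => l _; rewrite !raddf0.
- rewrite [in LHS]freegUZ linearZ /= eliftU [in LHS]linearZ /= /ract [X in _ *: X]fglift_push.
  rewrite (eq_fglift (g := fun z => \sum_(l < k.+1) ('C(k, l)%:R * height g ^+ (k - l)) *:
     ((height (z.2 * s (f g))%g - height (s (f g))) ^+ l *: << (z.1, f z.2 * f g)%g >>))).
    rewrite fglift_sum scaler_sumr; apply: eq_bigr => l _.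
    rewrite fglift_scale /moment liftU /= !linearZ /= fgliftU1 /shift /= !scalerA.
    congr (_ *: _); ring.
  move=> [j z] /=; rewrite gmulfM -heightB.
  under eq_bigr do rewrite scalerA.
  rewrite -scaler_suml; congr (_ *: _).
  rewrite -{1}[height (z * g)%g](subrK (height g)) addrC exprDn.
  by apply: eq_bigr => l _; rewrite mulr_natl mulrnAl.
rewrite !raddfD /= IHu IHv -big_split; apply: eq_bigr => l _ /=.
by rewrite !raddfD /=.
Qed.

Let shift0 y : shift 0 y = ract y.2 (push_ker (m y.1)).
Proof.
by rewrite /ract /push_ker push_comp; apply: eq_fglift => z; rewrite expr0 scale1r.
Qed.

Lemma moment_eq0 : (forall v, elift (push_ker \o m) v = 0 -> v = 0) ->
  forall v k, elift m v = 0 -> moment k v = 0.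
Proof.
move=> inj v k mv; have [n] := ubnP k; elim: n k => // n IHn k kn.
apply: inj; have := moment_elift k v; rewrite mv raddf0 big_ord_recl bin0 scale1r subn0.
rewrite big1 => [|l _]; last first.
  rewrite IHn ?raddf0 //; apply: leq_trans (kn : (k <= n)%N).
  by rewrite ltn_subrL /=; exact: leq_ltn_trans (ltn_ord l).
rewrite addr0 => ->; apply: eq_fglift => y; exact/esym/shift0.
Qed.

End Moments.

(** Vanishing of all moments lets any polynomial in the height be tested against the coefficients
    over one fibre; the polynomial with roots at all other heights of that fibre isolates one
    coefficient. *)
Lemma moment_inj (I : choiceType) (v : {freeg (I * G) / rat}) :
    (forall g g', g \in map snd (dom v) -> g' \in map snd (dom v) ->
      f g = f g' -> g <> g' -> chi (g^-1 * g')%g <> 0) ->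
  (forall k, moment k v = 0) -> v = 0.
Proof.
move=> chi_gen v0; apply: freeg_ext => y0; rewrite coeff0.
apply: contrapT => /eqP; rewrite -mem_dom => y0v.
pose P y := (y.1, f y.2) == (y0.1, f y0.2).
have poly0 (p : {poly rat}) : \sum_(y <- dom v | P y) coeff y v * p.[height y.2] = 0.
  under eq_bigr do rewrite horner_coef big_distrr /=.
  rewrite exchange_big /= big1 // => k _.
  transitivity (p`_k * coeff (y0.1, f y0.2) (moment k v)).
    rewrite /moment fgliftE raddf_sum /= big_distrr /= [LHS]big_mkcond.
    apply: eq_bigr => y _; rewrite !coeffZ coeffU mul1r.
    by rewrite -/(P y); case: (P y); rewrite ?mulr1 ?mulr0 // mulrCA.
  by rewrite v0 coeff0 mulr0.
pose p : {poly rat} := \prod_(y <- dom v | P y && (y != y0)) ('X - (height y.2)%:P).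
have := poly0 p; rewrite big_mkcond (bigD1_seq y0) ?uniq_dom //= /P eqxx.
rewrite big_seq_cond big1 ?addr0 => [|y /andP[yv yy0]]; last first.
  case: eqP => // /eqP Py; rewrite (_ : p.[_] = 0) ?mulr0 //.
  rewrite /p -big_filter horner_prod (big_rem y) /=; last by rewrite mem_filter /P Py yy0 yv.
  by rewrite hornerXsubC subrr mul0r.
move/eqP; rewrite mulf_eq0 => /orP[e|]; first by move: y0v; rewrite mem_dom e.
rewrite /p horner_prod prodf_seq_eq0 => /hasP[y yv] /andP[/andP[/eqP[e1 e2] yy0]].
rewrite hornerXsubC subr_eq0 => /eqP e.
apply: (chi_gen y.2 y0.2); rewrite ?map_f //.
  by move=> e'; move/eqP: yy0; apply; case: (y) (y0) e1 e' => [? ?] [? ?] /= -> ->.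
apply: (@addrI _ (height y.2)); rewrite addr0 -heightM ?mulVKg //.
exact: ker_same.
Qed.

End ConservativeExtension.

Lemma ptfa_conservative (G : groupType) : ptfa G -> conservative G.
Proof.
elim=> {G} [G G1|G H f f_surj f_comm f_tf _ IH] I J m m_inj v mv.
  have : aug v = 0 by apply: m_inj; rewrite -aug_elift mv raddf0.
  rewrite -(raddf0 (@aug rat G I)); apply: push_inj => -[i g] [j h] /= ->.
  by rewrite (G1 g) (G1 h).
have [s sK] := choice f_surj.
have [chi chiM chi_gen] := generic_ker_character f_comm f_tf
  [seq (g^-1 * g')%g | g <- map snd (dom v), g' <- map snd (dom v)].
apply: (moment_inj sK chiM) => [g g' gv g'v fg gg'|k].
  apply: chi_gen; first by apply/allpairsP; exists (g, g').
    exact: ker_same.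
  by move=> e; apply: gg'; apply: (mulgI g^-1%g); rewrite mulVg.
(* The map induced over H has the same augmentation as m, so [m_inj] is also the hypothesis that
   [IH] requires. *)
apply: (moment_eq0 sK chiM _ _ mv); apply: IH => u u0; apply: m_inj.
rewrite -{}u0; apply: eq_fglift => i /=.
by rewrite [RHS]push_comp; exact: eq_push.
Qed.

(** * Folner sets and rank *)

Section FolnerSets.
Local Open Scope nat_scope.

Definition boundary (G : groupType) (T S : seq G) : pred G :=
  fun s => has (fun t => (t * s)%g \notin S) T.

Definition folner (G : groupType) := forall (T : seq G) n,
  exists S, [/\ uniq S, S != [::] & n * count (boundary T S) S <= size S].

Lemma count_allpairs_le (A B : eqType) (C : Type) (g : A -> B -> C) (P : pred C)
    (Q : pred A) (R : pred B) s t :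
    (forall x y, x \in s -> y \in t -> P (g x y) -> Q x || R y) ->
  count P [seq g x y | x <- s, y <- t] <= count Q s * size t + size s * count R t.
Proof.
elim: s => // x s IHs PQR; rewrite /= count_cat count_map.
have {}IHs : count P [seq g x y | x <- s, y <- t] <= count Q s * size t + size s * count R t.
  by apply: IHs => y z ys zt; apply: PQR => //; rewrite inE ys orbT.
have : count (preim (g x) P) t <= Q x * size t + count R t.
  have [Qx|nQx] := boolP (Q x); first by rewrite mul1n (leq_trans (count_size _ _)) ?leq_addr.
  rewrite (eq_in_count (a2 := predI (preim (g x) P) R)).
    by apply: sub_count => y /= /andP[].
  move=> y yt /=; case Pxy : (P (g x y)) => //=; apply/esym.
  by move: (PQR x y (mem_head _ _) yt Pxy); rewrite (negPf nQx).
by move=> h; rewrite mulnDl mulSn addnACA; exact: leq_add h IHs.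
Qed.

Fixpoint box (G : groupType) (T : seq G) N : seq G :=
  if T is t :: T' then [seq (t ^+ i * x)%g | i <- iota 0 N, x <- box T' N] else [:: 1%g].

Lemma size_box (G : groupType) (T : seq G) N : size (box T N) = N ^ size T.
Proof. by elim: T => //= t T IH; rewrite size_allpairs size_iota IH expnS. Qed.

Lemma box_consP (G : groupType) (t : G) (T : seq G) N x :
  reflect (exists i y, [/\ i < N, y \in box T N & x = (t ^+ i * y)%g]) (x \in box (t :: T) N).
Proof.
apply: (iffP allpairsP) => [[[i y] /= [iN yT ->]]|[i [y [iN yT ->]]]].
  by exists i, y; rewrite mem_iota in iN.
by exists (i, y); rewrite mem_iota.
Qed.

Lemma box_mono (G : groupType) (T : seq G) N : {subset box T N <= box T N.+1}.
Proof.
elim: T => // t T IH _ /box_consP[i [x [iN xT ->]]].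
by apply/box_consP; exists i, x; split; [exact: ltnW | exact: IH |].
Qed.

Lemma box_mul (G : groupType) (T : seq G) N t x :
    (forall a b, a \in T -> b \in T -> commute a b) ->
  t \in T -> x \in box T N -> (t * x)%g \in box T N.+1.
Proof.
elim: T t x => // u T IH t _ Tc tT /box_consP[i [x [iN xT ->]]]; apply/box_consP.
have [->|tu] := eqVneq t u.
  by exists i.+1, x; split=> //; [exact: box_mono | rewrite mulgA -expgS].
have {}tT : t \in T by move: tT; rewrite inE (negPf tu).
exists i, (t * x)%g; split; first exact: ltnW.
  by apply: IH => // a b aT bT; apply: Tc; rewrite inE ?aT ?bT orbT.
rewrite !mulgA; congr (_ * _)%g; apply: commuteX.
by apply: Tc; rewrite inE ?eqxx ?tT ?orbT.
Qed.

Lemma poly_lt_exp c k : exists j, (1 + j * c) ^ k < 2 ^ j.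
Proof.
(* With j = 4^u one has 1 + jc <= 2^(2u + c), so it is enough that (2u + c)k < 4^u. Since u bounds
   2k and kc, the left side is at most u^2 + u, which is less than (2^u)^2. *)
pose u := 2 * k + k * c.
exists (2 ^ (2 * u)); set i := 2 * u.
have le1 : 1 + 2 ^ i * c <= 2 ^ (i + c).
  rewrite expnD; have := ltn_expl c (isT : 1 < 2); have := expn_gt0 2 i.
  by move: (2 ^ i) (2 ^ c) => a b /=; nia.
apply: leq_ltn_trans (_ : 2 ^ ((i + c) * k) < _).
  by rewrite expnM; case: k @u @i le1 => // k u i le1; rewrite leq_exp2r.
rewrite ltn_exp2l // /i expnM -[2 ^ 2]/4.
have := ltn_expl u (isT : 1 < 2).
rewrite (_ : 4 ^ u = 2 ^ u * 2 ^ u); last by rewrite -expnMn.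
by rewrite /u; move: (2 ^ _) => a; nia.
Qed.

(** If every increment exceeded the fraction 1/c of the current value, the sequence would double
    every c steps and outgrow N^k. *)
Lemma slow_growth (a : nat -> nat) c k :
    (forall N, a N <= a N.+1) -> (forall N, a N <= N ^ k) -> 0 < a 1 ->
  exists2 N, 0 < N & c * (a N.+1 - a N) <= a N.
Proof.
move=> a_mono a_poly a1; apply: contrapT => nogap.
have gap N : 0 < N -> a N < c * (a N.+1 - a N).
  by move=> N0; rewrite ltnNge; apply/negP => le; apply: nogap; exists N.
have a_le N j : a N <= a (N + j).
  by elim: j => [|j IH]; rewrite ?addn0 // addnS (leq_trans IH).
have step N j : 0 < N -> j * a N <= c * (a (N + j) - a N).
  move=> N0; elim: j => // j IH; rewrite addnS.
  have := gap (N + j) (ltn_addr _ N0); have := a_le N j; have := a_mono (N + j).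
  by nia.
have dbl N : 0 < N -> 2 * a N <= a (N + c).
  move=> N0; have := step N c N0; have := a_le N c.
  case: (c) (gap N N0) => [|d] //; rewrite leq_pmul2l // => _; lia.
have exp j : 2 ^ j <= a (1 + j * c).
  elim: j => // j IH; rewrite expnS (_ : 1 + j.+1 * c = 1 + j * c + c); last by rewrite mulSn; lia.
  by apply: leq_trans (dbl _ _) => //; rewrite leq_mul2l.
have [j] := poly_lt_exp c k; rewrite ltnNge => /negP; apply.
exact: leq_trans (exp j) (a_poly _).
Qed.

(** Boxes of exponents grow polynomially, so some box S N grows slowly. Each t in T sends its part
    of the boundary injectively into S N.+1 minus S N, whence the factor [size T]. The inclusion in
    a box is kept so that S stays in any subgroup containing T. *)
Lemma commuting_folner (G : groupType) (T : seq G) n :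
    (forall a b, a \in T -> b \in T -> commute a b) ->
  exists S N, [/\ uniq S, S != [::], {subset S <= box T N} &
    n * count (boundary T S) S <= size S].
Proof.
move=> Tc; pose S N := undup (box T N).
have Sm N : {subset S N <= S N.+1}.
  by move=> x; rewrite !mem_undup; exact: box_mono.
have [|||N N0 gap] := @slow_growth (fun N => size (S N)) (n * size T) (size T).
- by move=> N; apply: uniq_leq_size (undup_uniq _) (Sm N).
- by move=> N; rewrite -size_box size_undup.
- rewrite lt0n size_eq0; apply/eqP => /undup_nil e.
  by have := size_box T 1; rewrite e exp1n.
exists (S N), N; split; [exact: undup_uniq| | |].
- apply/eqP => /undup_nil e.
  by have := expn_gt0 N (size T); rewrite -size_box e N0.
- by move=> x; rewrite mem_undup.
apply: leq_trans gap; rewrite -mulnA leq_mul2l; apply/orP; right.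
have sub t : t \in T -> count (fun s => (t * s)%g \notin S N) (S N) <= size (S N.+1) - size (S N).
  move=> tT; rewrite -size_filter -(size_map (fun s => t * s)%g).
  set L := map _ _; rewrite leq_subRL; last exact: uniq_leq_size (undup_uniq _) (Sm N).
  rewrite -size_cat; apply: uniq_leq_size.
    rewrite cat_uniq undup_uniq map_inj_uniq ?filter_uniq ?undup_uniq //; last exact: mulgI.
    rewrite andbT; apply/hasPn => _ /mapP[x + ->] /=.
    by rewrite mem_filter => /andP[].
  move=> x; rewrite mem_cat => /orP[/Sm //|/mapP[y + ->]].
  by rewrite mem_filter !mem_undup => /andP[_ yN]; exact: box_mul.
move: sub; rewrite /boundary; elim: (T) => [|t T' IH] sub; first by rewrite /= count_pred0.
pose a1 s := (t * s)%g \notin S N; pose a2 s := has (fun t => (t * s)%g \notin S N) T'.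
rewrite (eq_count (a2 := predU a1 a2)) //.
rewrite mulSn; apply: leq_trans (_ : _ <= count a1 (S N) + count a2 (S N)) _.
  by rewrite -count_predUI leq_addr.
by apply: leq_add; [exact: sub (mem_head _ _)|apply: IH => u uT; apply: sub; rewrite inE uT orbT].
Qed.

(** The set is s(S') A with S' a Folner set of the quotient and A one of the kernel. Left
    multiplication by t moves s y to s(f t * y) times a correction in the kernel; A is chosen nearly
    invariant under the finite set [T'] of corrections. Each of the two sources of boundary gets
    half of the allowance, hence 2 * n. *)
Lemma ptfa_folner (G : groupType) : ptfa G -> folner G.
Proof.
elim=> {G} [G G1|G H f f_surj f_comm f_tf _ IH] T n.
  exists [:: 1%g]; split=> //; rewrite /= (_ : boundary _ _ _ = false) ?muln0 //.
  by apply/hasPn => t _; rewrite negbK (G1 (_ * _)%g) mem_head.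
have [s sK] := choice f_surj.
have [S' [S'u S'0 S'b]] := IH (map f T) (2 * n).
pose T' := [seq ((s (f t * y))^-1 * (t * s y))%g | t <- T, y <- S'].
have T'k a : a \in T' -> f a = 1%g.
  by move=> /allpairsP[[t y] /= [_ _ ->]]; apply: ker_same; rewrite gmulfM !sK.
have [|A [N [Au A0 AN Ab]]] := @commuting_folner G T' (2 * n).
  by move=> a b /T'k fa /T'k fb; exact: f_comm.
have Ak a : a \in A -> f a = 1%g.
  move=> /AN; elim: (T') T'k a => [|t T2 IH2] T2k a.
    by rewrite inE => /eqP ->; rewrite gmulf1.
  move=> /box_consP[i [x [_ xT ->]]].
  rewrite gmulfM gmulfXn (T2k t (mem_head _ _)) expg1n mul1g.
  by apply: IH2 xT => b bT; apply: T2k; rewrite inE bT orbT.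
pose S := [seq (s y * a)%g | y <- S', a <- A].
exists S; split.
- apply: allpairs_uniq => //= -[y a] [z b] /= /allpairsP[[y' a'] /= [_ a'A [-> ->]]].
  move=> /allpairsP[[z' b'] /= [_ b'A [-> ->]]] e.
  have yz : y' = z' by move: (congr1 f e); rewrite !gmulfM !sK (Ak a') // (Ak b') // !mulg1.
  by move: e; rewrite yz => /mulgI ->.
- by rewrite -size_eq0 size_allpairs muln_eq0 negb_or !size_eq0 S'0.
have le : count (boundary T S) S <=
    count (boundary (map f T) S') S' * size A + size S' * count (boundary T' A) A.
  apply: count_allpairs_le => y a yS' aA; rewrite /boundary => /hasP[t tT nS].
  apply/norP => -[/hasPn yb /hasPn ab]; move/negP: nS; apply.
  have ftS' : (f t * y)%g \in S' by have := yb (f t) (map_f f tT); rewrite negbK.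
  apply/allpairsP; exists ((f t * y)%g, ((s (f t * y))^-1 * (t * s y) * a)%g) => /=.
  split=> //; last by rewrite !mulgA mulgV mul1g.
  have := ab ((s (f t * y))^-1 * (t * s y))%g; rewrite negbK; apply.
  by apply/allpairsP; exists (t, y).
have := size_allpairs (fun y a => s y * a)%g S' A; rewrite -/S => ->.
by move: le S'b Ab; move: (count _ S) (count _ S') (count _ A) (size A) (size S'); nia.
Qed.

End FolnerSets.

(** * Dimension counts *)

Lemma freeg_kernel (Y Z : choiceType) (h : {linear {freeg Y / rat} -> {freeg Z / rat}})
    (s : seq Y) (t : seq Z) :
    uniq s -> (size t < size s)%N ->
    (forall y z, y \in s -> z \in dom (h << y >>) -> z \in t) ->
  exists2 x, x <> 0 & h x = 0.
Proof.
move=> s_uniq ts hst.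
pose A : 'M[rat]_(size s, size t) :=
  \matrix_(i, j) coeff (tnth (in_tuple t) j) (h << tnth (in_tuple s) i >>).
have : kermx A != 0.
  rewrite -mxrank_eq0 mxrank_ker subn_eq0 -ltnNge.
  exact: leq_ltn_trans (rank_leq_col _) ts.
move=> /rowV0Pn[w /sub_kermxP wA w0].
pose x : {freeg Y / rat} := \sum_i w 0 i *: << tnth (in_tuple s) i >>.
exists x.
  move=> x0; move/eqP: w0; apply; apply/rowP => i; rewrite mxE.
  have := congr1 (coeff (tnth (in_tuple s) i)) x0; rewrite coeff0 raddf_sum /=.
  rewrite (bigD1 i) //= coeffZ coeffU eqxx !mulr1 big1 ?addr0 // => j ji.
  by rewrite coeffZ coeffU (inj_eq (elimT (tuple_uniqP (in_tuple s)) s_uniq)) (negPf ji) !mulr0.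
apply: freeg_ext => z; rewrite coeff0 /x !raddf_sum /=.
have [zt|zt] := boolP (z \in t); last first.
  apply: big1 => i _; rewrite linearZ coeffZ coeff_outdom ?mulr0 //.
  by apply: contra zt; apply: hst; exact: mem_tnth.
have [j ->] : exists j, z = tnth (in_tuple t) j by apply/tnthP.
have := congr1 (fun u : 'rV_ _ => u 0 j) wA; rewrite !mxE => wAj.
rewrite -[RHS]wAj; apply: eq_bigr => i _; by rewrite linearZ coeffZ mxE.
Qed.

(** Vectors supported on I x S are mapped to vectors supported on J x (S + TB), where T collects the
    group elements occurring in m and B is the boundary of S. The Folner constant gives |J||T||B| <
    |S|, so the source has the larger dimension over Q. *)
Lemma folner_kernel (G : groupType) (I J : finType) (m : I -> {freeg (J * G) / rat}) :
  folner G -> (#|J| < #|I|)%N -> exists2 v, v <> 0 & elift m v = 0.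
Proof.
move=> Gf JI; pose T := undup (flatten [seq map snd (dom (m i)) | i <- enum I]).
have [S [Su S0 Sb]] := Gf T (#|J| * size T).+1.
pose B := [seq g <- S | boundary T S g].
pose s := [seq (i, g) | i <- enum I, g <- S].
pose t := [seq (j, h) | j <- enum J, h <- S ++ [seq (a * g)%g | a <- T, g <- B]].
have [|||v v0 mv] := @freeg_kernel _ _ (elift m) s t; last by exists v.
- by apply: allpairs_uniq; rewrite ?enum_uniq // => -[? ?] [? ?].
- rewrite !size_allpairs size_cat size_allpairs -!cardE /B size_filter.
  have : (0 < size S)%N by rewrite lt0n size_eq0.
  move: Sb JI; rewrite mulSn; move: (count _ S) (size S) (size T) #|J| #|I| => c a b j i cab ji a0.
  have jbc : (j * (b * c) < a)%N by move: cab; rewrite -mulnA; case: c => [|c]; lia.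
  have : (j.+1 * a <= i * a)%N by rewrite leq_mul2r ji orbT.
  by rewrite mulSn mulnDr; lia.
move=> [i g] [j h] /allpairsP[[i' g'] /= [_ gS [-> ->]]].
rewrite eliftU mem_dom coeff_ract -mem_dom => hm.
have aT : (h * g'^-1)%g \in T.
  rewrite mem_undup; apply/flattenP; exists (map snd (dom (m i'))).
    by apply: map_f; rewrite mem_enum.
  by apply/mapP; exists (j, h * g'^-1)%g.
apply/allpairsP; exists (j, h); rewrite mem_enum; split=> //=.
rewrite mem_cat; have [//|hS] := boolP (h \in S).
apply/allpairsP; exists ((h * g'^-1)%g, g'); rewrite /= mulgVK; split=> //.
rewrite mem_filter gS andbT; apply/hasP; exists (h * g'^-1)%g => //.
by rewrite mulgVK.
Qed.

Lemma ptfa_kernel (G : groupType) (I J : finType) (m : I -> {freeg (J * G) / rat}) :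
  ptfa G -> (#|J| < #|I|)%N -> exists2 v, v <> 0 & elift m v = 0.
Proof. by move=> /ptfa_folner; exact: folner_kernel. Qed.

Lemma kernel_complement s (Z : choiceType)
    (h : {linear {freeg 'I_s / rat} -> {freeg Z / rat}}) :
  exists t r (V : 'I_t -> {freeg 'I_s / rat}) (C : 'I_r -> {freeg 'I_s / rat}),
    [/\ (s <= t + r)%N, forall i, h (V i) = 0,
        forall x, fglift V x = 0 -> x = 0 &
        forall y, h (fglift C y) = 0 -> y = 0].
Proof.
pose rv k (u : {freeg 'I_k / rat}) : 'rV[rat]_k := \row_j coeff j u.
pose fg k (w : 'rV[rat]_k) : {freeg 'I_k / rat} := \sum_j w 0 j *: << j >>.
have fgK k : cancel (@fg k) (@rv k).
  move=> w; apply/rowP => i; rewrite mxE raddf_sum /= (bigD1 i) //=.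
  rewrite coeffZ coeffU eqxx !mulr1 big1 ?addr0 // => j ji.
  by rewrite coeffZ coeffU (negPf ji) !mulr0.
have rvK k : cancel (@rv k) (@fg k).
  move=> u; apply: freeg_ext => i; have := fgK k (rv k u) => /rowP/(_ i).
  by rewrite !mxE.
have rv0 k : rv k 0 = 0 by apply/rowP => i; rewrite !mxE coeff0.
have fglift_mx k l (B : 'M[rat]_(k, l)) u : fglift (fun i => fg l (row i B)) u = fg l (rv k u *m B).
  apply: (can_inj (rvK l)); rewrite fgK; apply/rowP => j; rewrite !mxE fgliftE raddf_sum /=.
  rewrite (eq_bigr (fun i => coeff i u * B i j)) => [|i _]; last first.
    by rewrite coeffZ; have /rowP/(_ j) := fgK l (row i B); rewrite !mxE => ->.
  pose r := [seq i <- enum 'I_k | i \notin dom u].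
  transitivity (\sum_(i <- dom u ++ r) rv k u 0 i * B i j).
    rewrite big_cat /= [X in _ + X]big1_seq ?addr0.
      by apply: eq_bigr => i _; rewrite mxE.
    by move=> i /=; rewrite mem_filter => /andP[iu _]; rewrite mxE coeff_outdom ?mul0r.
  rewrite -[RHS]big_enum; apply: perm_big; apply: uniq_perm.
  - rewrite cat_uniq uniq_dom filter_uniq ?enum_uniq // andbT.
    by apply/hasPn => i; rewrite mem_filter => /andP[].
  - exact: enum_uniq.
  - by move=> i; rewrite mem_cat mem_filter mem_enum andbT orbN.
(* Z may be infinite, but only finitely many of its coordinates occur in the image of h, so h is
   given by a matrix. *)
pose zs := flatten [seq dom (h << j >>) | j <- enum 'I_s].
pose A : 'M[rat]_(s, size zs) := \matrix_(i, j) coeff (tnth (in_tuple zs) j) (h << i >>).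
have hA w : h (fg s w) = 0 <-> w *m A = 0.
  have hw z : coeff z (h (fg s w)) = \sum_i w 0 i * coeff z (h << i >>).
    by rewrite !raddf_sum; apply: eq_bigr => i _ /=; rewrite linearZ coeffZ.
  split=> [e|e].
    apply/rowP => j; rewrite !mxE.
    transitivity (coeff (tnth (in_tuple zs) j) (h (fg s w))); last by rewrite e coeff0.
    by rewrite hw; apply: eq_bigr => i _; rewrite mxE.
  apply: freeg_ext => z; rewrite coeff0 hw.
  have [zz|zz] := boolP (z \in zs); last first.
    apply: big1 => i _; rewrite coeff_outdom ?mulr0 //; apply: contra zz => zi.
    by apply/flattenP; exists (dom (h << i >>)) => //; apply: map_f; rewrite mem_enum.
  have [j ->] : exists j, z = tnth (in_tuple zs) j by apply/tnthP.
  have := congr1 (fun u : 'rV_ _ => u 0 j) e; rewrite !mxE => ej.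
  by rewrite -[RHS]ej; apply: eq_bigr => i _; rewrite mxE.
pose K := kermx A.
exists (\rank K), (\rank K^C)%MS, (fun i => fg s (row i (row_base K))),
  (fun i => fg s (row i (row_base K^C)%MS)); split.
- by rewrite mxrank_compl subnKC ?rank_leq_col.
- move=> i; apply/hA; apply/sub_kermxP.
  by apply: submx_trans (row_sub _ _) _; rewrite eq_row_base.
- move=> x; rewrite fglift_mx => /(congr1 (rv s)); rewrite fgK rv0 => e.
  rewrite -[x]rvK; have : rv _ x *m row_base K = 0 *m row_base K by rewrite mul0mx.
  move=> /(row_free_inj (row_base_free K)) ->; apply: (can_inj (rvK _)).
  by rewrite fgK rv0.
move=> y; rewrite fglift_mx => /hA/sub_kermxP yK.
have yC : (rv _ y *m row_base K^C <= K^C)%MS.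
  by apply: submx_trans (submxMl _ _) _; rewrite eq_row_base.
have : (rv _ y *m row_base K^C <= K :&: K^C)%MS by rewrite sub_capmx yK.
rewrite capmx_compl submx0 => /eqP e.
have {}e : rv _ y *m row_base K^C%MS = 0 *m row_base K^C%MS by rewrite mul0mx.
rewrite -[y]rvK (row_free_inj (row_base_free _) e); apply: (can_inj (rvK _)).
by rewrite fgK rv0.
Qed.

(** * Linear independence modulo the relators *)

Section RankInjective.
Context (G : groupType) (I J : choiceType) (s : nat).
Context (W : I -> {freeg (J * G) / rat}) (d : 'I_s -> {freeg (J * G) / rat}).

(** Over Q, the s vectors [d] have t independent relations, each lifted to Q[G], and a complement of
    dimension r on which the augmented [d] is injective. Any b is dependent on these t + r vectors
    of Q[G]^s, up to a factor g; the relation W a + d b = 0 times g then involves only [W] and the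
    complement, where Strebel's theorem applies. *)
Lemma rank_injective : ptfa G ->
    (forall q b, fglift (aug \o W) q + fglift (aug \o d) b = 0 -> q = 0) ->
    (forall c, fglift (aug \o d) c = 0 -> exists k, elift d k = 0 /\ aug k = c) ->
  forall a b, elift W a + elift d b = 0 -> a = 0.
Proof.
move=> Gp W_inj d_lift a b ab.
have [t [r [V [C [str Vd V_inj C_inj]]]]] := kernel_complement (fglift (aug \o d)).
have [c cP] := choice (fun i => d_lift _ (Vd i)).
pose e i : {freeg ('I_s * G) / rat} := push (fun j => (j, 1%g)) (C i).
have aug_e i : aug (e i) = C i by rewrite /aug push_comp -[RHS]push_id.
pose m (x : unit + ('I_t + 'I_r)) := match x with
  | inl _ => b | inr (inl i) => c i | inr (inr i) => e i end.
(* These are 1 + t + r > s vectors of Q[G]^s. Below, g, x and y are the coefficients of b, of the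
   [c i] and of the [e i]. *)
have [|v v0 mv] := @ptfa_kernel G _ _ m Gp; first by rewrite !card_sum card_unit !card_ord.
have [g [v' vE]] : exists g v', v = push (fun y : unit * G => (inl y.1, y.2)) g
    + push (fun y : ('I_t + 'I_r) * G => (inr y.1, y.2)) v'.
  by apply: push_cover => -[[x|x] z]; [left|right]; exists (x, z).
have [x [y v'E]] : exists x y, v' = push (fun y : 'I_t * G => (inl y.1, y.2)) x
    + push (fun y : 'I_r * G => (inr y.1, y.2)) y.
  by apply: push_cover => -[[z|z] w]; [left|right]; exists (z, w).
have bg : act b (push snd g) + (elift c x + elift e y) = 0.
  rewrite -mv vE v'E !raddfD /= !elift_push; congr (_ + _).
  by rewrite [LHS]fglift_push.
pose M (z : I + 'I_r) := match z with inl i => W i | inr i => elift d (e i) end.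
(* Applying [elift d] kills the [c i] and turns b into - W a, leaving W(a g) - d(e y) = 0. The
   family [M] made of [W] and the d(e i) is injective after augmentation. *)
have [ag y0] : act a (push snd g) = 0 /\ - y = 0.
  apply: (@push_disjoint _ _ _ _ (fun y : I * G => (inl y.1, y.2))
    (fun y : 'I_r * G => (inr y.1, y.2))).
  - by move=> [? ?] [? ?] [-> ->].
  - by move=> [? ?] [? ?] [-> ->].
  - by [].
  apply: (@ptfa_conservative _ Gp _ _ M) => [u|]; last first.
    rewrite raddfD /= !elift_push elift_act raddfN /=.
    rewrite -[elift (M \o inr) _](elift_comp d e).
    have -> : elift e y = - act b (push snd g) - elift c x.
      by have /eqP := bg; rewrite addrA addrC addr_eq0 opprD => /eqP.
    rewrite raddfB raddfN /= elift_act elift_comp.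
    rewrite {3}/elift fgliftE big1 ?subr0 => [|z _]; last by rewrite /= (cP z.1).1 raddf0 scaler0.
    by rewrite opprK -actDl ab act0l.
  have [q [z ->]] : exists q z, u = push inl q + push inr z.
    by apply: push_cover => -[w|w]; [left|right]; exists w.
  rewrite raddfD /= !fglift_push => e0.
  have zE : fglift (aug \o d) (fglift C z) = fglift ((aug \o M) \o inr) z.
    rewrite [LHS]fglift_comp; apply: eq_fglift => w /=.
    by rewrite aug_elift aug_e.
  have q0 : q = 0 by apply: (W_inj q (fglift C z)); rewrite -[RHS]e0; congr (_ + _).
  rewrite q0 raddf0 add0r; suff -> : z = 0 by rewrite raddf0.
  by apply: C_inj; apply: (etrans zE); rewrite -e0 q0 raddf0 add0r.
(* If g = 0, the dependence reduces to one among the [c i], whose augmentations [V] are independent;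
   then v = 0, a contradiction. *)
have [g0|/eqP g0] := eqVneq (push snd g) 0; last exact: ptfa_no_zero_divisor Gp ag g0.
have {}y0 : y = 0 by rewrite -[y]opprK y0 oppr0.
case: v0; rewrite vE v'E y0 raddf0 addr0.
have -> : g = 0.
  by apply: (@push_inj _ _ _ (@snd unit G)); rewrite ?g0 ?raddf0 // => -[[] ?] [[] ?] /= ->.
suff -> : x = 0 by rewrite !raddf0 addr0.
apply: (@ptfa_conservative _ Gp _ _ c) => [u|]; last first.
  by move: bg; rewrite g0 y0 !raddf0 add0r addr0.
rewrite (eq_fglift (g := V)) => [|w]; first exact: V_inj.
by rewrite /= (cP w).2.
Qed.

End RankInjective.

(** * Fox calculus *)

Section IntegralLift.
Context (K : choiceType) (V : zmodType).

Definition zlift (f : K -> V) (u : {freeg K / int}) : V :=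
  \sum_(k <- dom u) f k *~ coeff k u.

Lemma zlift_sup f (s : seq K) u : uniq s -> {subset dom u <= s} ->
  zlift f u = \sum_(k <- s) f k *~ coeff k u.
Proof.
move=> s_uniq us; rewrite [RHS](bigID (fun k => k \in dom u)) /= [X in _ + X]big1 ?addr0.
  rewrite -big_filter; apply: perm_big; apply: uniq_perm; rewrite ?uniq_dom ?filter_uniq //.
  by move=> k; rewrite mem_filter; case: (boolP (k \in dom u)) => // /us ->.
by move=> k ku; rewrite coeff_outdom ?mulr0z.
Qed.

Lemma zlift_zmod_morphism f : zmod_morphism (zlift f).
Proof.
move=> u v; pose s := undup (dom u ++ dom v).
have sE w : {subset dom w <= dom u ++ dom v} -> zlift f w = \sum_(k <- s) f k *~ coeff k w.
  by move=> sub; apply: zlift_sup; [exact: undup_uniq | move=> k /sub; rewrite mem_undup].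
rewrite !sE; first by rewrite -sumrB; apply: eq_bigr => k _; rewrite coeffB mulrzBr.
- by move=> k kv; rewrite mem_cat kv orbT.
- by move=> k ku; rewrite mem_cat ku.
- exact: domB.
Qed.

HB.instance Definition _ f :=
  GRing.isZmodMorphism.Build {freeg K / int} V (zlift f) (zlift_zmod_morphism f).

Lemma zliftU1 f k : zlift f << k >> = f k.
Proof. by rewrite /zlift domU1 big_seq1 coeffU eqxx mulr1 mulr1z. Qed.

End IntegralLift.

Lemma freeg_int_ind (K : choiceType) (P : {freeg K / int} -> Prop) :
    P 0 -> (forall k, P << k >>) -> (forall u v, P u -> P v -> P (u - v)) ->
  forall u, P u.
Proof.
move=> P0 P1 PB; have PN v : P v -> P (- v) by rewrite -sub0r; exact: PB.
have PD u v : P u -> P v -> P (u + v).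
  by move=> Pu Pv; rewrite -[v]opprK; apply: (PB _ _ Pu); exact: PN.
have PMn k n : P (<< k >> *+ n).
  by elim: n => // n IHn; rewrite mulrS; exact: (PD _ _ (P1 k)).
apply: freeg_ind_add => // n k; have -> : << n *g k >> = << k >> *~ n :> {freeg K / int}.
  by rewrite freegU_mulz intz.
by case: n => n; [exact: PMn | rewrite NegzE mulrNz; apply: PN; exact: PMn].
Qed.

Lemma eq_additive_freeg (K : choiceType) (V : zmodType)
    (f g : {additive {freeg K / int} -> V}) :
  (forall k, f << k >> = g << k >>) -> forall u, f u = g u.
Proof.
move=> fg; apply: freeg_int_ind => [||u v]; rewrite ?raddf0 //.
by rewrite !raddfB => -> ->.
Qed.

Section Rationalization.

(** Magnus's theorem concerns integral Fox derivatives, while the dimension counts take place over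
    Q. *)
Definition toQ {K : choiceType} : {freeg K / int} -> {freeg K / rat} :=
  zlift (fun k => << k >>).

HB.instance Definition _ (K : choiceType) := GRing.Additive.on (@toQ K).

Implicit Types K L : choiceType.

Lemma toQU1 K (k : K) : toQ << k >> = << k >>.
Proof. exact: zliftU1. Qed.

Lemma coeff_toQ K k (u : {freeg K / int}) : coeff k (toQ u) = (coeff k u)%:~R.
Proof.
rewrite /toQ /zlift raddf_sum /=.
transitivity (\sum_(l <- dom u) ((coeff k (<< coeff l u *g l >> : {freeg K / int}))%:~R : rat)).
  apply: eq_bigr => l _; rewrite raddfMz /= !coeffU mul1r intrM mulrC -[_ *~ _]mulrzr.
  by congr (_ * _); case: eqP.
rewrite -[in RHS](freeg_sumE u) raddf_sum /= raddf_sum.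
by [].
Qed.

Lemma toQ_inj K : injective (@toQ K).
Proof.
move=> u v e; apply: freeg_ext => k; apply: (@intr_inj rat).
by rewrite -!coeff_toQ e.
Qed.

Lemma toQ_eq0 K (u : {freeg K / int}) : toQ u = 0 -> u = 0.
Proof. by move=> u0; apply: toQ_inj; rewrite u0 raddf0. Qed.

Lemma toQ_fglift K L (f : K -> {freeg L / int}) u :
  toQ (fglift f u) = fglift (toQ \o f) (toQ u).
Proof.
apply: (@eq_additive_freeg _ _ (toQ \o fglift f)%FUN (fglift (toQ \o f) \o @toQ K)%FUN) => k /=.
by rewrite fgliftU1 toQU1 fgliftU1.
Qed.

Lemma toQ_push K L (f : K -> L) u : toQ (push f u) = push f (toQ u).
Proof. by rewrite toQ_fglift; apply: eq_fglift => k /=; exact: toQU1. Qed.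

Lemma toQ_ract (G : groupType) K g (u : {freeg (K * G) / int}) :
  toQ (ract g u) = ract g (toQ u).
Proof. exact: toQ_push. Qed.

Lemma toQ_aug (G : groupType) K (u : {freeg (K * G) / int}) : toQ (aug u) = aug (toQ u).
Proof. exact: toQ_push. Qed.

Lemma toQ_elift (G : groupType) K L (m : K -> {freeg (L * G) / int}) u :
  toQ (elift m u) = elift (toQ \o m) (toQ u).
Proof. by rewrite toQ_fglift; apply: eq_fglift => k /=; exact: toQ_push. Qed.

Lemma toQ_act (G : groupType) K (u : {freeg (K * G) / int}) c :
  toQ (act u c) = act (toQ u) (toQ c).
Proof. by rewrite toQ_fglift; apply: eq_fglift => k /=; exact: toQ_push. Qed.

Lemma toQ_common_denominator K (u : {freeg K / rat}) :
  exists (n : int) (v : {freeg K / int}), n <> 0 /\ u *~ n = toQ v.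
Proof.
elim/freeg_ind_add: u => [|a k|u v [n [u' [n0 uE]]] [m [v' [m0 vE]]]].
- by exists 1, 0; rewrite raddf0 mul0rz.
- exists (denq a), (<< k >> *~ numq a); split; first exact/eqP/denq_neq0.
  rewrite raddfMz /= toQU1 freeg_mulz freegU_mulz; congr [freeg [:: (_, _)]].
  by rewrite -mulrzr -[X in X * _](divq_num_den a) divfK ?intr_eq0 ?denq_neq0.
exists (n * m), (u' *~ m + v' *~ n); split; first by apply/eqP; rewrite mulf_neq0 //; apply/eqP.
rewrite mulrzDl raddfD /= !raddfMz /= -uE -vE -!mulrzA.
by rewrite [m * n]mulrC.
Qed.

End Rationalization.

(** * Crossed homomorphisms and free groups *)

Section CrossedHom.
Context (F G : groupType) (X : choiceType) (p : {ghom F -> G}).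

Definition crossed (D : F -> {freeg (X * G) / int}) :=
  forall x y, D (x * y)%g = ract (p y) (D x) + D y.

Variable D : F -> {freeg (X * G) / int}.
Hypothesis DM : crossed D.

Lemma crossed1 : D 1%g = 0.
Proof.
apply: (@addrI _ (D 1%g)); rewrite addr0.
by have := DM 1%g 1%g; rewrite mulg1 gmulf1 ract1.
Qed.

Lemma crossedV x : D (x^-1)%g = - ract (p x)^-1%g (D x).
Proof.
by apply/esym/addr0_eq; rewrite -gmulfV -DM mulgV crossed1.
Qed.

Lemma crossedF x y : D (x / y)%g = ract (p y)^-1%g (D x - D y).
Proof. by rewrite DM crossedV gmulfV raddfB. Qed.

Lemma crossed_ker x y : p y = 1%g -> D (x * y)%g = D x + D y.
Proof. by move=> py; rewrite DM py ract1. Qed.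

Lemma crossed_kerV x : p x = 1%g -> D (x^-1)%g = - D x.
Proof. by move=> px; rewrite crossedV px invg1 ract1. Qed.

Lemma crossedJ x g : p x = 1%g -> D (x ^ g)%g = ract (p g) (D x).
Proof.
move=> px; rewrite conjgE !DM crossedV gmulfM px mul1g raddfN /= ractM mulVg ract1.
by rewrite addrC addrK.
Qed.

Lemma crossed_commutator x : commutator_subgroup (kerN p) x -> D x = 0.
Proof.
apply: (generated_min (A := [set x | D x = 0])).
  by split=> [|a b /=]; [exact: crossed1 | rewrite crossedF => -> ->; rewrite subrr raddf0].
move=> _ [a [b [pa pb ->]]] /=; rewrite commgEl crossed_ker; last first.
  by rewrite gmulfJ pa conj1g.
by rewrite crossed_kerV // crossedJ // pb ract1 addNr.
Qed.

End CrossedHom.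

Section FoxGroup.
Context (X : choiceType) (G : groupType).

(* The semidirect product of the free right Z[G]-module on X with G: a
   homomorphism into it lifting p : F -> G is a crossed homomorphism. *)
Definition foxgroup : Type := ({freeg (X * G) / int} * G)%type.

HB.instance Definition _ := Choice.on foxgroup.

Let mul (a b : foxgroup) : foxgroup := (ract b.2 a.1 + b.1, a.2 * b.2)%g.
Let one : foxgroup := (0, 1%g).
Let inv (a : foxgroup) : foxgroup := (- ract a.2^-1%g a.1, a.2^-1)%g.

Let mulA : associative mul.
Proof. by move=> a b c; rewrite /mul /= raddfD /= ractM addrA mulgA. Qed.

Let mul1 : left_id one mul.
Proof. by case=> v g; rewrite /mul /= raddf0 add0r mul1g. Qed.

Let mulr1 : right_id one mul.
Proof. by case=> v g; rewrite /mul /= ract1 addr0 mulg1. Qed.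

Let mulV : left_inverse one inv mul.
Proof. by case=> v g; rewrite /mul /= raddfN /= ractM mulVg ract1 addNr. Qed.

Let mulrV : right_inverse one inv mul.
Proof. by case=> v g; rewrite /mul /= subrr mulgV. Qed.

HB.instance Definition _ := isGroup.Build foxgroup mulA mul1 mulr1 mulV mulrV.

Definition fox_snd (a : foxgroup) : G := a.2.

HB.instance Definition _ := isMultiplicative.Build foxgroup G fox_snd (fun a b => erefl).
HB.instance Definition _ :=
  Multiplicative_isUMagmaMorphism.Build foxgroup G fox_snd erefl.

Lemma foxgroup_mul (a b : foxgroup) : (a * b)%g = (ract b.2 a.1 + b.1, a.2 * b.2)%g.
Proof. by []. Qed.

End FoxGroup.

Record subgroup (G : groupType) := Subgroup {
  subgroup_set :> set G;
  subgroup_setP : is_subgroup subgroup_set }.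

Section SubgroupGroup.
Context (G : groupType) (A : subgroup G).

Definition sgrp := set_type A.

HB.instance Definition _ := SubChoice.on sgrp.

Lemma sgrp_closed : group_closed [in (A : set G)].
Proof.
have [A1 AF] := subgroup_setP A.
by split=> [|x y]; rewrite !inE //; exact: AF.
Qed.

HB.instance Definition _ := SubChoice_isSubGroup.Build G _ sgrp sgrp_closed.

Definition sgrp_incl : {ghom sgrp -> G} := val.

End SubgroupGroup.

Section FreeGroups.
Context (F : groupType) (X : choiceType) (i : X -> F).
Hypothesis F_free : free_on i.

Lemma free_on_ext (H : groupType) (f f' : {ghom F -> H}) :
  (forall x, f (i x) = f' (i x)) -> f =1 f'.
Proof.
move=> ff' y; have [h _ h_uniq] := F_free (f \o i).
by rewrite (h_uniq f) // (h_uniq f') // => x /=.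
Qed.

(** The universal property maps F to the group A; followed by the inclusion, this map agrees with
    the identity on the basis, hence everywhere. This replaces induction on words. *)
Lemma free_on_ind (A : set F) : is_subgroup A -> (forall x, A (i x)) -> forall y, A y.
Proof.
move=> sA Ai y; pose B := Subgroup sA.
have Bi x : i x \in (B : set F) by rewrite inE.
have [f fi _] := F_free (fun x => Sub (i x) (Bi x) : sgrp B).
have e : (sgrp_incl B \o f)%FUN =1 idfun.
  by apply: (@free_on_ext F (sgrp_incl B \o f)%FUN idfun) => x /=; rewrite fi.
have := valP (f y); rewrite inE.
by have /= := e y; rewrite /sgrp_incl => ->.
Qed.

Lemma fox_exists (G : groupType) (p : {ghom F -> G}) :
  exists2 D : F -> {freeg (X * G) / int},
    crossed p D & forall x, D (i x) = << (x, 1%g) >>.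
Proof.
have [f fi _] := F_free (fun x => (<< (x, 1%g) >>, p (i x)) : foxgroup X G).
have fp : (@fox_snd X G \o f)%FUN =1 p.
  by apply: (@free_on_ext G (@fox_snd X G \o f)%FUN p) => x /=; rewrite fi.
exists (fun y => (f y).1) => [y z|x]; last by rewrite fi.
by rewrite gmulfM foxgroup_mul /= -(fp z).
Qed.

Section Fox.
Context (G : groupType) (p : {ghom F -> G}) (D : F -> {freeg (X * G) / int}).
Hypothesis DM : crossed p D.
Hypothesis Di : forall x, D (i x) = << (x, 1%g) >>.

Lemma fox_chain_rule (E : groupType) (Y : choiceType) (q : {ghom E -> G})
    (D' : E -> {freeg (Y * G) / int}) (w : {ghom F -> E}) :
    crossed q D' -> (forall x, q (w x) = p x) ->
  forall x, D' (w x) = elift (fun z => D' (w (i z))) (D x).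
Proof.
move=> D'M qw; apply: free_on_ind => [|x]; last by rewrite Di eliftU ract1.
split=> [|x y /= ex ey]; first by rewrite gmulf1 (crossed1 DM) (crossed1 D'M) raddf0.
by rewrite gmulfF (crossedF DM) (crossedF D'M) elift_ract (raddfB (elift _)) /= -ex -ey qw.
Qed.

(** [aug (D x)] is the vector of exponent sums of x. *)
Lemma fox_exponents u : exists x, aug (D x) = u.
Proof.
elim/freeg_int_ind: u => [|z|_ _ [x <-] [y <-]].
- by exists 1%g; rewrite (crossed1 DM) raddf0.
- by exists (i z); rewrite Di /aug pushU.
by exists (x / y)%g; rewrite (crossedF DM) aug_ract raddfB.
Qed.

Lemma fox_abelianization x : aug (D x) = 0 -> commutator_subgroup setT x.
Proof.
move=> Dx; apply/ab_class_eq0.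
suff -> : ab_class x = zlift (fun z => ab_class (i z)) (aug (D x)) by rewrite Dx raddf0.
move: x {Dx}; apply: free_on_ind => [|x]; last first.
  by rewrite Di /aug pushU zliftU1.
split=> [|x y /= ex ey]; first by rewrite (crossed1 DM) !raddf0 ab_class1.
by rewrite (crossedF DM) aug_ract !raddfB /= -ex -ey ab_classM ab_classV.
Qed.

(* Magnus: the Schreier generators s(p(x) g)^-1 x s(g) define a left inverse of
   the map induced by [D] on the abelianized kernel. *)
Lemma fox_kernel x : p x = 1%g -> D x = 0 -> commutator_subgroup (kerN p) x.
Proof.
move=> px Dx.
have [s sP] : exists s : G -> F, forall y, p (s (p y)) = p y.
  (* A section over the image of p only, with default value 1 elsewhere. *)
  have /choice[s sP] : forall g, exists x, forall y, p y = g -> p x = g.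
    move=> g; have [[y <-]|ng] := pselect (exists y, p y = g); first by exists y.
    by exists 1%g => y yg; case: ng; exists y.
  by exists s => y; exact: sP.
pose e x g := ((s (p x * g))^-1 * (x * s g))%g.
pose L := zlift (fun y : X * G => ab_of (kerN p) (e (i y.1) y.2)).
have L0 : L 0 = 0 by exact: raddf0.
have LB u v : L (u - v) = L u - L v by exact: raddfB.
have ek y z : p (e y (p z)) = 1%g.
  rewrite /e -[(p y * p z)%g]gmulfM; apply: ker_same.
  by rewrite sP !gmulfM sP.
suff /(_ x 1%g) : forall x y, L (ract (p y) (D x)) = ab_of (kerN p) (e x (p y)).
  rewrite Dx raddf0 L0 /e gmulf1 mulg1 px => /esym.
  (* The section need not send 1 to 1, so the case y = 1 yields the class of a conjugate of x by
     [s 1]; normality of the commutator subgroup undoes the conjugation. *)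
  have ps : p (s 1%g) = 1%g by have := sP 1%g; rewrite !gmulf1.
  have xk : (kerN p : set F) (x ^ s 1%g)%g by exact: normalJ.
  rewrite -conjgE => xs0; have xs := (ab_of_eq0 xk).1 xs0.
  rewrite -[x](conjgK (s 1%g)).
  exact: (commutator_subgroup_normal (normal_setP (kerN p))).2.
move=> {px Dx} {}x; move: x; apply: free_on_ind => [|x y]; last first.
  by rewrite Di ractU mul1g /L zliftU1.
split=> [y|x y ex ey z].
  by rewrite (crossed1 DM) raddf0 L0 /e gmulf1 !mul1g mulVg ab_of1.
rewrite (crossedF DM) ractM -gmulfV -gmulfM raddfB LB ex ey.
rewrite -ab_ofV -?ab_ofM ?kerE ?gmulfV ?ek ?invg1 //; congr ab_of.
rewrite /e invgM invgK invgM !mulgA mulgK.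
have -> : (p y * p (y^-1 * z) = p z)%g by rewrite -gmulfM mulVKg.
by have -> : (p x * p (y^-1 * z) = p (x / y) * p z)%g by rewrite -!gmulfM mulgA.
Qed.

End Fox.
End FreeGroups.

(** * The torsion-free derived series *)

Section GroupRing.
Context (R : nzRingType) (G : groupType).
Implicit Types (c d : {freeg G / R}).

Definition cmul c : {freeg G / R} -> {freeg G / R} :=
  fglift (fun g => push (fun h => h * g)%g c).

HB.instance Definition _ c := GRing.Linear.on (cmul c).

Lemma act_cmul c d :
  act (push (pair tt) c) d = push (pair tt) (cmul c d) :> {freeg (unit * G) / R}.
Proof.
rewrite [RHS]fglift_comp; apply: eq_fglift => g /=.
by rewrite /ract !push_comp.
Qed.

End GroupRing.

(** The right Ore condition: two vectors of a free module of rank one are dependent by the dimension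
    count. Clearing denominators makes the coefficients integral, and the absence of zero divisors
    makes the common multiple nonzero. *)
Lemma ptfa_ore (G : groupType) (c d : {freeg G / int}) : ptfa G -> c <> 0 -> d <> 0 ->
  exists a b, cmul c a <> 0 /\ cmul c a + cmul d b = 0.
Proof.
move=> Gp c0 d0.
pose u (i : bool) : {freeg (unit * G) / int} := push (pair tt) (if i then c else d).
have [|v v0 uv] := @ptfa_kernel G bool unit (toQ \o u) Gp; first by rewrite card_bool card_unit.
have [n [w [n0 vw]]] := toQ_common_denominator v.
have uw : elift u w = 0 by apply: toQ_eq0; rewrite toQ_elift -vw raddfMz /= uv mul0rz.
have w0 : w <> 0.
  move=> w0; apply: v0; apply/eqP; have /eqP : v *~ n = 0 by rewrite vw w0 raddf0.
  by rewrite -scaler_int scaler_eq0 intr_eq0 => /orP[/eqP|].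
have [a [b wE]] : exists a b, w = push (pair true) a + push (pair false) b.
  by apply: push_cover => -[[] g]; [left|right]; exists g.
have pI (T : Type) (t : T) : injective (pair t : G -> T * G) by move=> g h [].
have ab : cmul c a + cmul d b = 0.
  apply: (@push_inj _ _ _ (pair tt) (pI _ tt)).
  rewrite raddf0 raddfD /= -!act_cmul -uw wE raddfD /=.
  by rewrite /elift !fglift_push.
have cI e (x : {freeg G / int}) : e <> 0 -> cmul e x = 0 -> x = 0.
  move=> e0 ex; apply: contrapT => x0; apply: e0.
  apply: (@push_inj _ _ _ (pair tt) (pI _ tt)); rewrite raddf0.
  by apply: ptfa_no_zero_divisor Gp _ x0; rewrite act_cmul ex raddf0.
exists a, b; split=> // ca.
have a0 := cI _ _ c0 ca.
have b0 : b = 0 by apply: (cI d) => //; rewrite -ab ca add0r.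
by apply: w0; rewrite wE a0 b0 !raddf0 addr0.
Qed.

Section TorsionStep.
Context (G : groupType) (N : normal_subgroup G).
Local Notation M := (abelianization (subgrp N)).
Implicit Types (m : M) (q : quotg N) (c : {freeg (quotg N) / int}).

Definition ab_conjr q m : M := ab_conj m q.

Lemma ab_conj_zmod_morphism q : zmod_morphism (ab_conjr q).
Proof.
rewrite /ab_conjr => m m'; have [x Nx ->] := ab_ofP m; have [y Ny ->] := ab_ofP m'.
rewrite -[q]reprK -ab_ofV // -ab_ofM //; last exact: normalV.
rewrite !ab_conj_of //; last by apply: normalM => //; exact: normalV.
rewrite conjMg conjVg ab_ofM ?ab_ofV //; try exact: normalJ.
by apply: normalV; exact: normalJ.
Qed.

HB.instance Definition _ q :=
  GRing.isZmodMorphism.Build M M (ab_conjr q) (ab_conj_zmod_morphism q).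

Lemma ab_conjM m q r : ab_conj m (q * r)%g = ab_conj (ab_conj m q) r.
Proof.
have [x Nx ->] := ab_ofP m; rewrite -[q]reprK -[r]reprK -gmulfM.
by rewrite !ab_conj_of ?conjgM //; exact: normalJ.
Qed.

Lemma ab_act_zmod_morphism m : zmod_morphism (ab_act m).
Proof. exact: zlift_zmod_morphism. Qed.

HB.instance Definition _ m :=
  GRing.isZmodMorphism.Build {freeg (quotg N) / int} M (ab_act m) (ab_act_zmod_morphism m).

Lemma ab_actU1 m q : ab_act m << q >> = ab_conj m q.
Proof. exact: zliftU1. Qed.

Lemma ab_actBl m m' c : ab_act (m - m') c = ab_act m c - ab_act m' c.
Proof.
rewrite /ab_act -sumrB; apply: eq_bigr => q _.
by rewrite -mulrzBl; congr (_ *~ _); exact: ab_conj_zmod_morphism.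
Qed.

Lemma ab_act0l c : ab_act 0 c = 0.
Proof. by have := ab_actBl 0 0 c; rewrite !subrr. Qed.

Lemma ab_actMzl m c k : ab_act m (c *~ k) = ab_act (m *~ k) c.
Proof.
rewrite raddfMz /= /ab_act mulrz_suml; apply: eq_bigr => q _.
by rewrite -[ab_conj (m *~ k) q]/(ab_conjr q (m *~ k)) raddfMz /= -!mulrzA mulrC.
Qed.

Lemma ab_actA m c d : ab_act m (cmul c d) = ab_act (ab_act m c) d.
Proof.
apply: (@eq_additive_freeg _ _ (ab_act m \o cmul c)%FUN (ab_act (ab_act m c))) => r /=.
rewrite /cmul fgliftU1 ab_actU1.
apply: (@eq_additive_freeg _ _ (ab_act m \o push (fun h => h * r)%g)%FUN
  (ab_conjr r \o ab_act m)%FUN) => q /=.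
by rewrite pushU !ab_actU1 ab_conjM.
Qed.

Lemma torsion_stepP x : torsion_free_step N x <->
  (N : set G) x /\ exists c, c <> 0 /\ ab_act (ab_of N x) c = 0.
Proof.
split=> [[y <-] [c [c0 yc]]|[Nx [c [c0 xc]]]].
  split; first by have := valP y; rewrite inE.
  by exists c; rewrite ab_of_val.
have Nx' : x \in (N : set G) by rewrite inE.
exists (Sub x Nx'); first by [].
by exists c; rewrite -ab_of_val.
Qed.

Lemma torsion_step_sub x : torsion_free_step N x -> (N : set G) x.
Proof. by move=> /torsion_stepP[]. Qed.

Lemma freegU1_neq0 (K : choiceType) (k : K) : << k >> <> 0 :> {freeg K / int}.
Proof. by move=> /(congr1 (coeff k)) /eqP; rewrite coeffU eqxx coeff0. Qed.

Lemma torsion_step_commutator x : commutator_subgroup N x -> torsion_free_step N x.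
Proof.
move=> xN; have Nx := commutator_sub xN; apply/torsion_stepP; split=> //.
exists << 1%g >>; split; first exact: freegU1_neq0.
by rewrite (ab_of_eq0 Nx).2 // ab_act0l.
Qed.

Lemma torsion_step_tf x n : (N : set G) x ->
  torsion_free_step N (x ^+ n.+1)%g -> torsion_free_step N x.
Proof.
move=> Nx /torsion_stepP[_ [c [c0 xc]]]; apply/torsion_stepP; split=> //.
exists (c *~ n.+1); split; last by rewrite ab_actMzl -pmulrn -ab_ofX.
move=> cn; apply: c0; apply: freeg_ext => q; have := congr1 (coeff q) cn.
by rewrite raddfMz /= !coeff0 mulrzz => /eqP; rewrite mulf_eq0 orbF => /eqP.
Qed.

(** A common right multiple of annihilators of x and y annihilates both classes, hence that of x /
    y. For the conjugate by g, the annihilator of x is multiplied on the left by g^-1. *)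
Lemma torsion_step_normal : ptfa (quotg N) -> is_normal (torsion_free_step N).
Proof.
move=> Qp; split; first split=> [|x y].
- apply: torsion_step_commutator; exact: (generated_subgroup _).1.
- move=> /torsion_stepP[Nx [c [c0 xc]]] /torsion_stepP[Ny [d [d0 yd]]].
  apply/torsion_stepP; split; first by apply: normalM => //; exact: normalV.
  have [a [b [ca0 cadb]]] := ptfa_ore Qp c0 d0.
  exists (cmul c a); split=> //.
  rewrite ab_ofM ?ab_ofV //; last exact: normalV.
  rewrite ab_actBl ab_actA xc ab_act0l sub0r.
  have -> : cmul c a = - cmul d b by apply/eqP; rewrite -addr_eq0 cadb.
  by rewrite raddfN /= ab_actA yd ab_act0l !oppr0.
move=> x g /torsion_stepP[Nx [c [c0 xc]]]; apply/torsion_stepP.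
split; first exact: normalJ.
exists (push (fun h => (\pi_(quotg N) g)^-1 * h)%g c); split.
  move=> e; apply: c0; apply: (@push_inj _ _ _ (fun h => (\pi_(quotg N) g)^-1 * h)%g).
    exact: mulgI.
  by rewrite e raddf0.
rewrite -ab_conj_of // -{}xc; set m := ab_of N x.
apply: (@eq_additive_freeg _ _
  (ab_act (ab_conj m (\pi g)) \o push (fun h => (\pi_(quotg N) g)^-1 * h)%g)%FUN
  (ab_act m)) => h /=.
by rewrite pushU !ab_actU1 -ab_conjM mulVKg.
Qed.

End TorsionStep.

Section QuotientMap.
Context (G : groupType) (N' N : normal_subgroup G).
Hypothesis sub : (N' : set G) `<=` N.

Definition quot_proj (a : quotg N') : quotg N := \pi_(quotg N) (repr a).

Lemma quot_projE x : quot_proj (\pi x) = \pi_(quotg N) x.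
Proof. by apply/quotgP; apply: sub; exact: quotg_reprP. Qed.

Lemma quot_projM : {morph quot_proj : a b / a * b >-> a * b}%g.
Proof. by move=> a b; rewrite -[a]reprK -[b]reprK -gmulfM !quot_projE gmulfM. Qed.

Lemma quot_proj1 : quot_proj 1%g = 1%g.
Proof. by rewrite -(pi_quotg1 N') quot_projE pi_quotg1. Qed.

End QuotientMap.

Lemma pi_quotg_eq1 (G : groupType) (N : normal_subgroup G) (x : G) :
  \pi_(quotg N) x = 1%g <-> (N : set G) x.
Proof.
rewrite -(pi_quotg1 N); split=> [/esym/quotgP|Nx]; first by rewrite invg1 mul1g.
by apply/esym/quotgP; rewrite invg1 mul1g.
Qed.

Lemma ptfa_quotient (G : groupType) (N' N : normal_subgroup G) :
    (N' : set G) `<=` N -> commutator_subgroup N `<=` N' ->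
    (forall x n, (N : set G) x -> (N' : set G) (x ^+ n.+1)%g -> (N' : set G) x) ->
  ptfa (quotg N) -> ptfa (quotg N').
Proof.
move=> sub comm tf.
pose f0 := @quot_proj G N' N.
pose m1 := isMultiplicative.Build (quotg N') (quotg N) f0 (quot_projM sub).
pose f1 : Multiplicative.type _ _ := HB.pack f0 m1.
pose m2 := Multiplicative_isUMagmaMorphism.Build (quotg N') (quotg N) f1 (quot_proj1 sub).
pose f : {ghom (quotg N') -> (quotg N)} := HB.pack f0 m1 m2.
have fE x : f (\pi x) = \pi_(quotg N) x by exact: quot_projE.
apply: (@ptfa_extension _ _ f) => [y|a b|a n].
- by exists (\pi_(quotg N') (repr y)); rewrite fE reprK.
- rewrite -[a]reprK -[b]reprK !fE => /pi_quotg_eq1 Na /pi_quotg_eq1 Nb.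
  apply/commgP/eqP; rewrite -gmulfR; apply/pi_quotg_eq1; apply: comm.
  by apply: generated_sub; exists (repr a), (repr b).
- rewrite -[a]reprK fE -gmulfXn => /pi_quotg_eq1 Na /pi_quotg_eq1 Nan.
  by apply/pi_quotg_eq1; exact: tf Nan.
Qed.

Section TorsionFreeDerived.
Context (G : groupType).

(** Tied to normality of the terms: the Ore condition for the present quotient makes the next term
    normal, so that its normal closure is the term itself and the next quotient gains a torsion-free
    abelian layer. *)
Lemma tf_derived_ptfa n : ptfa (quotg (tf_derivedN G n)).
Proof.
elim: n => [|n IHn].
  apply: ptfa_trivial => x; rewrite -[x]reprK; apply/pi_quotg_eq1.
  by rewrite /= (normal_closure_id (is_normal_setT G)).
have tE : (tf_derivedN G n.+1 : set G) = torsion_free_step (tf_derivedN G n).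
  exact: normal_closure_id (torsion_step_normal IHn).
apply: ptfa_quotient IHn; rewrite tE.
- exact: torsion_step_sub.
- exact: torsion_step_commutator.
- by move=> x m; exact: torsion_step_tf.
Qed.

Lemma tf_derivedS n : (tf_derivedN G n.+1 : set G) = torsion_free_step (tf_derivedN G n).
Proof. exact: normal_closure_id (torsion_step_normal (tf_derived_ptfa n)). Qed.

Lemma tf_derivedN0 x : (tf_derivedN G 0 : set G) x.
Proof. by rewrite /= (normal_closure_id (is_normal_setT G)). Qed.

Lemma tf_derived_anti m n : (m <= n)%N -> (tf_derivedN G n : set G) `<=` tf_derivedN G m.
Proof.
elim: n => [|n IHn]; first by rewrite leqn0 => /eqP ->.
rewrite leq_eqVlt => /orP[/eqP -> //|mn] x; rewrite tf_derivedS => /torsion_step_sub.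
exact: IHn.
Qed.

Lemma derived_sub_tf n : (derived G n : set G) `<=` tf_derivedN G n.
Proof.
elim: n => [|n IHn] x; first by move=> _; exact: tf_derivedN0.
apply: generated_min; first exact: (normal_setP (tf_derivedN G n.+1)).1.
move=> _ [y [z [Gy Gz ->]]]; rewrite tf_derivedS; apply: torsion_step_commutator.
by apply: generated_sub; exists y, z; split=> //; exact: IHn.
Qed.

End TorsionFreeDerived.

(** * The bar complex in low degrees *)

Section LowDegreeBar.
Context (G : groupType).
Implicit Types (x y z : G).

Definition bar1 x : bar_chain G 1 := << [tuple x] >>.
Definition bar2 x y : bar_chain G 2 := << [tuple x; y] >>.
Definition bar3 x y z : bar_chain G 3 := << [tuple x; y; z] >>.

Lemma bar_boundary_bar1 x : bar_boundary (bar1 x) = 0.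
Proof.
rewrite /bar1 bar_boundaryU !big_ord_recl big_ord0 addr0 /= !mul1r expr0 expr1.
rewrite (_ : bar_face_tuple _ _ = [tuple]); last exact: val_inj.
rewrite (_ : bar_face_tuple _ _ = [tuple]); last exact: val_inj.
by rewrite freegUD subrr freegU0.
Qed.

Lemma bar_boundary_bar2 x y :
  bar_boundary (bar2 x y) = bar1 y - bar1 (x * y)%g + bar1 x.
Proof.
rewrite /bar2 bar_boundaryU !big_ord_recl big_ord0 addr0 /= !mul1r.
rewrite (_ : bar_face_tuple _ _ = [tuple y]); last exact: val_inj.
rewrite (_ : bar_face_tuple _ _ = [tuple (x * y)%g]); last exact: val_inj.
rewrite (_ : bar_face_tuple _ _ = [tuple x]); last exact: val_inj.
rewrite /bar1 freegUN addrA; congr (_ + << _ *g _ >> + << _ *g _ >>).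
Qed.

Lemma bar_boundary_bar3 x y z : bar_boundary (bar3 x y z) =
  bar2 y z - bar2 (x * y)%g z + bar2 x (y * z)%g - bar2 x y.
Proof.
rewrite /bar3 bar_boundaryU !big_ord_recl big_ord0 addr0 /= !mul1r.
rewrite (_ : bar_face_tuple _ _ = [tuple y; z]); last exact: val_inj.
rewrite (_ : bar_face_tuple _ _ = [tuple (x * y)%g; z]); last exact: val_inj.
rewrite (_ : bar_face_tuple _ _ = [tuple x; (y * z)%g]); last exact: val_inj.
rewrite (_ : bar_face_tuple _ _ = [tuple x; y]); last exact: val_inj.
rewrite /bar2 !freegUN !addrA.
congr (_ + << _ *g _ >> + << _ *g _ >> + << _ *g _ >>).
Qed.

Lemma tuple1E (t : 1.-tuple G) : t = [tuple thead t].
Proof. by case/tupleP: t => x t; rewrite (tuple0 t) theadE; apply: val_inj. Qed.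

Lemma tuple2E (t : 2.-tuple G) : t = [tuple tnth t ord0; tnth t ord_max].
Proof.
case/tupleP: t => x t; rewrite (tuple1E t); apply: val_inj => /=.
by rewrite (tnth_nth x).
Qed.

Lemma tuple3P (t : 3.-tuple G) : exists x y z, t = [tuple x; y; z].
Proof.
case/tupleP: t => x t; rewrite (tuple2E t); eexists x, _, _.
by apply: val_inj.
Qed.

Section Cochains.
Context (V : lmodType rat).

Definition cochain1 (f : G -> V) : bar_chain G 1 -> V := fglift (fun t => f (thead t)).
Definition cochain2 (f : G -> G -> V) : bar_chain G 2 -> V :=
  fglift (fun t => f (tnth t ord0) (tnth t ord_max)).

HB.instance Definition _ f := GRing.Linear.on (cochain1 f).
HB.instance Definition _ f := GRing.Linear.on (cochain2 f).

Lemma cochain1E f x : cochain1 f (bar1 x) = f x.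
Proof. by rewrite /cochain1 fgliftU1. Qed.

Lemma cochain2E f x y : cochain2 f (bar2 x y) = f x y.
Proof. by rewrite /cochain2 fgliftU1. Qed.

End Cochains.

Lemma chain2_ind (P : bar_chain G 2 -> Prop) : P 0 -> (forall u v, P u -> P v -> P (u + v)) ->
  (forall k u, P u -> P (k *: u)) -> (forall x y, P (bar2 x y)) -> forall u, P u.
Proof.
move=> P0 PD PZ P1; apply: freeg_ind_add => // k t; rewrite freegUZ; apply: PZ.
by rewrite (tuple2E t); exact: P1.
Qed.

Lemma chain3_ind (P : bar_chain G 3 -> Prop) : P 0 -> (forall u v, P u -> P v -> P (u + v)) ->
  (forall k u, P u -> P (k *: u)) -> (forall x y z, P (bar3 x y z)) -> forall u, P u.
Proof.
move=> P0 PD PZ P1; apply: freeg_ind_add => // k t; rewrite freegUZ; apply: PZ.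
by have [x [y [z ->]]] := tuple3P t; exact: P1.
Qed.

Lemma bar_boundaryZ n k (u : bar_chain G n) : bar_boundary (k *: u) = k *: bar_boundary u.
Proof. by case: n u => [|n] u; [rewrite /= scaler0 | exact: fgliftZ]. Qed.

Lemma bar_boundaryD n (u v : bar_chain G n) :
  bar_boundary (u + v) = bar_boundary u + bar_boundary v.
Proof. exact: raddfD. Qed.

Lemma bar_boundaryN n (u : bar_chain G n) : bar_boundary (- u) = - bar_boundary u.
Proof. exact: raddfN. Qed.

Lemma bar_boundaryB n (u v : bar_chain G n) :
  bar_boundary (u - v) = bar_boundary u - bar_boundary v.
Proof. exact: raddfB. Qed.

Lemma bar_boundary0 n : bar_boundary (0 : bar_chain G n) = 0.
Proof. exact: raddf0. Qed.

Lemma cochain1_boundary (V : lmodType rat) (f : G -> V) (u : bar_chain G 2) :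
  {morph f : x y / (x * y)%g >-> x + y} -> cochain1 f (bar_boundary u) = 0.
Proof.
move=> fM; elim/chain2_ind: u => [|u v IHu IHv|k u IH|x y].
- by rewrite bar_boundary0 raddf0.
- by rewrite bar_boundaryD raddfD /= IHu IHv addr0.
- by rewrite bar_boundaryZ linearZ /= IH scaler0.
rewrite bar_boundary_bar2 raddfD raddfB /= !cochain1E fM.
by rewrite opprD addrA (addrAC (f y)) subrr add0r addNr.
Qed.

(** [bar1] turns products into sums up to boundaries, so the elements with [bar1 x] a boundary form
    a subgroup that contains the commutators. *)
Lemma commutator_boundary x : commutator_subgroup setT x ->
  exists u : bar_chain G 2, bar_boundary u = bar1 x.
Proof.
pose hom (a b : bar_chain G 1) := exists u : bar_chain G 2, bar_boundary u = a - b.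
have homD a b c e : hom a b -> hom c e -> hom (a + c) (b + e).
  move=> [u ua] [v vc]; exists (u + v); rewrite bar_boundaryD ua vc.
  by rewrite opprD addrACA.
have homN a b : hom a b -> hom (- a) (- b).
  by move=> [u ua]; exists (- u); rewrite bar_boundaryN ua opprD.
have homt a b c : hom a b -> hom b c -> hom a c.
  by move=> [u ua] [v vb]; exists (u + v); rewrite bar_boundaryD ua vb addrA subrK.
have homr a : hom a a by exists 0; rewrite bar_boundary0 subrr.
have homM a b : hom (bar1 (a * b)%g) (bar1 a + bar1 b).
  exists (- bar2 a b); rewrite bar_boundaryN bar_boundary_bar2.
  by apply: freeg_ext => t; rewrite !(coeffB, coeffD, coeffN); ring.
have hom1 : hom (bar1 1%g) 0.
  by exists (bar2 1%g 1%g); rewrite bar_boundary_bar2 mulg1 subrr add0r subr0.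
have homV a : hom (bar1 a^-1%g) (- bar1 a).
  have [u] := homM a a^-1%g; have [v] := hom1; rewrite mulgV => vE uE.
  exists (v - u); rewrite bar_boundaryB vE uE.
  by apply: freeg_ext => t; rewrite !(coeffB, coeffD, coeffN, coeff0); ring.
suff xH : hom (bar1 x) 0 -> exists u : bar_chain G 2, bar_boundary u = bar1 x.
  move=> xG; apply: xH; move: x xG.
  apply: (generated_min (A := [set x | hom (bar1 x) 0])) => [|_ [a [b [_ _ ->]]] /=].
    split=> // a b /= Ha Hb; apply: (homt _ _ _ (homM _ _)); rewrite -[0]addr0.
    by apply: (homD) => //; apply: (homt _ _ _ (homV b)); rewrite -[0]oppr0; exact: homN.
  rewrite commgEl; apply: (homt _ _ _ (homM _ _)); rewrite -[0](addNr (bar1 a)).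
  apply: (homD _ _ _ _ (homV a)); rewrite conjgE; apply: (homt _ _ _ (homM _ _)).
  have -> : bar1 a = - bar1 b + (bar1 a + bar1 b).
    by apply: freeg_ext => t; rewrite !(coeffB, coeffD, coeffN); ring.
  exact: homD (homV b) (homM _ _).
by move=> [u uE]; exists u; rewrite uE subr0.
Qed.

End LowDegreeBar.

Lemma bar_map_bar1 (G K : groupType) (f : {ghom G -> K}) x : bar_map f (bar1 x) = bar1 (f x).
Proof. by rewrite /bar1 bar_mapU; congr << _ *g _ >>; apply: val_inj. Qed.

Lemma bar_map_bar2 (G K : groupType) (f : {ghom G -> K}) x y :
  bar_map f (bar2 x y) = bar2 (f x) (f y).
Proof. by rewrite /bar2 bar_mapU; congr << _ *g _ >>; apply: val_inj. Qed.

Lemma bar_mapZ (G K : groupType) (f : {ghom G -> K}) n k (u : bar_chain G n) :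
  bar_map f (k *: u) = k *: bar_map f u.
Proof. exact: fgliftZ. Qed.

Lemma homology_class_eq (C2 C1 C0 : zmodType) (d2 : {additive C2 -> C1})
    (d1 : {additive C1 -> C0}) (x y : cycleT d1) :
  homology_class d2 x = homology_class d2 y <-> exists c, val x - val y = d2 c.
Proof.
rewrite /homology_class; split=> [/eqP|[c xy]].
  by rewrite -Quotient.idealrBE inE => -[c e]; exists c; rewrite -e raddfB.
apply/eqP; rewrite -Quotient.idealrBE inE; exists c.
by rewrite raddfB /= xy.
Qed.

Lemma rat_homology_mapE (G K : groupType) (f : {ghom G -> K}) n
    (z : cycleT (@bar_boundary G n)) (y : cycleT (@bar_boundary K n)) :
  val y = bar_map f (val z) ->
  rat_homology_map f n (homology_class (@bar_boundary G n.+1) z) =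
  homology_class (@bar_boundary K n.+1) y.
Proof.
move=> yE; apply: (etrans (@homology_mapE _ _ _ _ _ _ (@bar_boundary G n.+1)
  (@bar_boundary G n) (@bar_boundary K n.+1) (@bar_boundary K n)
  (@bar_map G K f n.+1) (@bar_map G K f n) (@bar_map G K f n.-1)
  (@bar_map_boundary G K f n.+1) (@bar_map_boundary G K f n) z)).
by congr homology_class; apply: val_inj; rewrite yE.
Qed.

(** The class of [f x] vanishes in rational H_1, hence so does that of x. An explicit bounding chain
    is returned because rational characters can be evaluated on it. *)
Lemma H1_injective_commutator (G K : groupType) (f : {ghom G -> K}) x :
    injective (rat_homology_map f 1) -> commutator_subgroup setT (f x) ->
  exists u : bar_chain G 2, bar_boundary u = bar1 x.
Proof.
move=> f_inj fx; have [w wE] := commutator_boundary fx.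
have cx : bar1 x \in is_cycle (@bar_boundary G 1) by apply/eqP; exact: bar_boundary_bar1.
pose z : cycleT (@bar_boundary G 1) := Sub (bar1 x) cx.
have [c cE] : exists c : bar_chain G 2,
    val z - val (0 : cycleT (@bar_boundary G 1)) = bar_boundary c.
  apply/homology_class_eq; apply: f_inj.
  have cy : bar1 (f x) \in is_cycle (@bar_boundary K 1) by apply/eqP; exact: bar_boundary_bar1.
  rewrite (rat_homology_mapE (y := Sub (bar1 (f x)) cy)); last by rewrite /= bar_map_bar1.
  rewrite (rat_homology_mapE (y := 0)); last by rewrite (raddf0 (@bar_map G K f 1)).
  by apply/homology_class_eq; exists w; apply: etrans (esym wE); exact: subr0.
by exists c; rewrite -cE subr0.
Qed.

Lemma H2_spanned_by_chain (G : groupType) (N : normal_subgroup G) (z : bar_chain G 2) :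
    H2_spanned_by N -> bar_boundary z = 0 ->
  exists (y : bar_chain (subgrp N) 2) (w : bar_chain G 3),
    bar_boundary y = 0 /\ z = bar_map (subgrp_incl N) y + bar_boundary w.
Proof.
move=> sp z0; have cz : z \in is_cycle (@bar_boundary G 2) by apply/eqP.
have [x xE] := sp (homology_class (@bar_boundary G 3) (Sub z cz)).
move: xE; rewrite -[x]reprK; set y := repr x.
have cy : bar_map (subgrp_incl N) (val y) \in is_cycle (@bar_boundary G 2).
  apply/eqP; apply: etrans (esym (bar_map_boundary (subgrp_incl N) (val y))) _.
  apply: etrans (congr1 (@bar_map _ _ (subgrp_incl N) 1) (eqP (valP y))) _.
  exact: (raddf0 (@bar_map (subgrp N) G (subgrp_incl N) 1)).
pose y' : cycleT (@bar_boundary G 2) := Sub (bar_map (subgrp_incl N) (val y)) cy.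
rewrite (rat_homology_mapE (y := y')) // => /esym/homology_class_eq [w wE].
exists (val y), w; split; first by apply/eqP; exact: valP y.
by rewrite -wE /= addrC subrK.
Qed.

(** * Relations and second homology *)

Section Presentation.
Context (E B G : groupType) (Y : choiceType) (j : Y -> E).
Context (p : {ghom E -> B}) (q : {ghom B -> G}) (R : seq E).
Hypothesis E_free : free_on j.
Hypothesis p_surj : forall b, exists e, p e = b.
Hypothesis p_ker : forall e, p e = 1%g <-> normal_closure [set r | r \in R] e.

Let qp : {ghom E -> G} := (q \o p)%FUN.
Variable D : E -> {freeg (Y * G) / int}.
Hypothesis DM : crossed qp D.
Hypothesis Dj : forall y, D (j y) = << (y, 1%g) >>.

Definition relator (k : 'I_(size R)) : E := tnth (in_tuple R) k.

Let d k := toQ (D (relator k)).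

Lemma relator_ker k : p (relator k) = 1%g.
Proof.
apply/p_ker => A _ RA; apply: RA; exact: mem_tnth.
Qed.

Let qp_ker e : p e = 1%g -> qp e = 1%g.
Proof. by move=> /= ->; rewrite gmulf1. Qed.

(** On the kernel of [qp], D is additive and turns conjugation into the action of G, so the elements
    there whose image lies in the span of the relators form a normal subgroup of E. *)
Lemma fox_relations e : p e = 1%g -> exists l, elift d l = toQ (D e).
Proof.
move=> /p_ker pe.
suff [] : qp e = 1%g /\ exists l, elift d l = toQ (D e) by [].
apply: (pe [set e | qp e = 1%g /\ exists l, elift d l = toQ (D e)]); last first.
  move=> r rR; have [k ->] : exists k, r = relator k by apply/tnthP.
  split; first by apply: qp_ker; exact: relator_ker.
  by exists << (k, 1%g) >>; rewrite eliftU ract1.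
split; first split.
- by split; [rewrite gmulf1 | exists 0; rewrite (crossed1 DM) !raddf0].
- move=> x y [qx [l lx]] [qy [m my]]; split; first by rewrite gmulfF qx qy mulgV.
  by exists (l - m); rewrite raddfB /= lx my (crossedF DM) qy invg1 ract1 raddfB.
move=> x g [qx [l lx]]; split; first by rewrite gmulfJ qx conj1g.
by exists (ract (qp g) l); rewrite elift_ract lx (crossedJ DM) // toQ_ract.
Qed.

Let W (u : {freeg 'I_(size R) / rat}) := exists k, elift d k = 0 /\ aug k = u.

Let W0 : W 0. Proof. by exists 0; rewrite !raddf0. Qed.

Let WD u v : W u -> W v -> W (u + v).
Proof. by move=> [k [dk <-]] [l [dl <-]]; exists (k + l); rewrite !raddfD /= dk dl addr0. Qed.

Let WZ c u : W u -> W (c *: u).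
Proof. by move=> [k [dk <-]]; exists (c *: k); rewrite !linearZ /= dk scaler0. Qed.

Let WN u : W u -> W (- u).
Proof. by move=> Wu; rewrite -scaleN1r; exact: WZ. Qed.

Let WB u v : W u -> W v -> W (u - v).
Proof. by move=> Wu Wv; apply: WD => //; exact: WN. Qed.

(* Modulo the Q-relations [W] that lift to Q[G]-relations, [aug \o lam] is a
   conjugation invariant homomorphism on the kernel of [p], so composing it with
   the extension cocycle of [p] gives a 2-cocycle [Psi] on B.  On the 2-cycle
   attached to r in ker p and in [E, E] its value is minus the class of r, while it
   vanishes on cycles supported in a subgroup killed by [q], where [D \o s] makes
   the cocycle a coboundary. *)
Section Lifts.
Variables (lam : E -> {freeg ('I_(size R) * G) / rat}) (s : B -> E).
Hypothesis lamP : forall e, p e = 1%g -> elift d (lam e) = toQ (D e).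
Hypothesis sK : cancel s p.

Let al e := aug (lam e).

(** [lam] is a mere choice of coefficients; as D is additive on the kernel, its defect of additivity
    is a Q[G]-relation, whose augmentation lies in [W] by definition. *)
Let alM x y : p x = 1%g -> p y = 1%g -> W (al (x * y)%g - al x - al y).
Proof.
move=> px py; exists (lam (x * y)%g - lam x - lam y); rewrite !raddfB /=; split=> //.
rewrite !lamP // ?gmulfM ?px ?py ?mulg1 // (crossed_ker DM) ?raddfD /=; last exact: qp_ker.
by apply: freeg_ext => k; rewrite !(coeffB, coeffD, coeff0); ring.
Qed.

Let alJ x g : p x = 1%g -> W (al (x ^ g)%g - al x).
Proof.
move=> px; exists (lam (x ^ g)%g - ract (qp g) (lam x)); rewrite !raddfB /= aug_ract; split=> //.
rewrite elift_ract !lamP // ?gmulfJ ?px ?conj1g // (crossedJ DM) ?toQ_ract ?subrr //.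
exact: qp_ker.
Qed.

Let c x y := (s x * s y / s (x * y))%g.

Let c_ker x y : p (c x y) = 1%g.
Proof. by rewrite gmulfF gmulfM !sK mulgV. Qed.

Local Notation Psi := (cochain2 (fun x y => al (c x y))).

Let Psi_boundary (w : bar_chain B 3) : W (Psi (bar_boundary w)).
Proof.
elim/chain3_ind: w => [|u v IHu IHv|k u IH|x y z].
- by rewrite bar_boundary0 raddf0; exact: W0.
- by rewrite bar_boundaryD raddfD; exact: WD.
- by rewrite bar_boundaryZ linearZ; exact: WZ.
rewrite bar_boundary_bar3 raddfB raddfD raddfB /= !cochain2E.
(* The non-abelian cocycle identity of the extension; modulo [W], [al] forgets the conjugation. *)
have e : (c x y * c (x * y) z = (c y z) ^ (s x)^-1 * c x (y * z))%g.
  by rewrite /c conjgE invgK !mulgA !mulgVK.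
have := alM (c_ker x y) (c_ker (x * y)%g z); rewrite e => W1.
have cJ : p (c y z ^ (s x)^-1)%g = 1%g by rewrite gmulfJ c_ker conj1g.
have W2 := alM cJ (c_ker x (y * z)%g).
have W3 := alJ (s x)^-1%g (c_ker y z).
have := WB (WB W1 W2) W3; congr W.
by apply: freeg_ext => k; rewrite !(coeffB, coeffD); ring.
Qed.

Local Notation T := (cochain1 (fun x => al (x / s (p x))%g)).

Let t_ker x : p (x / s (p x))%g = 1%g.
Proof. by rewrite gmulfF sK mulgV. Qed.

(** Pulled back to E the extension splits, and x / s (p x) provides a primitive of its cocycle, up
    to sign. *)
Let Psi_map (u : bar_chain E 2) : W (Psi (bar_map p u) + T (bar_boundary u)).
Proof.
elim/chain2_ind: u => [|u v IHu IHv|k u IH|x y].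
- by rewrite bar_boundary0 (raddf0 (@bar_map _ _ p 2)) !raddf0 addr0; exact: W0.
- rewrite bar_boundaryD (raddfD (@bar_map _ _ p 2)) !raddfD /=.
  by rewrite addrACA; exact: WD.
- by rewrite bar_boundaryZ bar_mapZ !linearZ -scalerDr; exact: WZ.
rewrite bar_map_bar2 bar_boundary_bar2 cochain2E raddfD raddfB /= !cochain1E.
have e : ((x * y) / s (p (x * y)) =
    (x / s (p x)) * ((y / s (p y)) ^ (s (p x))^-1 * c (p x) (p y)))%g.
  by rewrite /c conjgE invgK gmulfM !mulgA !mulgVK.
have yJ : p ((y / s (p y)) ^ (s (p x))^-1)%g = 1%g by rewrite gmulfJ t_ker conj1g.
have W1 := alM yJ (c_ker (p x) (p y)).
have := alM (t_ker x) (_ : p ((y / s (p y)) ^ (s (p x))^-1 * c (p x) (p y))%g = 1%g).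
rewrite -e gmulfM yJ c_ker mulg1 => /(_ erefl) W2.
have W3 := alJ (s (p x))^-1%g (t_ker y).
have := WN (WD (WD W1 W2) W3); congr W.
by apply: freeg_ext => k; rewrite !(coeffB, coeffD, coeffN); ring.
Qed.

Let Psi_sub (N : normal_subgroup B) (u : bar_chain (subgrp N) 2) :
    (forall x, (N : set B) x -> q x = 1%g) -> bar_boundary u = 0 ->
  W (Psi (bar_map (subgrp_incl N) u)).
Proof.
move=> qN u0.
(* The lift is the value of the same cochain before augmentation. Its image under [elift d] is a
   cochain evaluated on the boundary of u, hence zero. *)
exists (cochain2 (fun x y => lam (c x y)) (bar_map (subgrp_incl N) u)); split; last first.
  by rewrite [LHS]fglift_comp.
suff -> : elift d (cochain2 (fun x y => lam (c x y)) (bar_map (subgrp_incl N) u)) =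
    cochain1 (fun x : subgrp N => toQ (D (s (val x)))) (bar_boundary u) by rewrite u0 raddf0.
elim/chain2_ind: {u0} u => [|u v IHu IHv|k u IH|x y].
- by rewrite bar_boundary0 (raddf0 (@bar_map _ _ (subgrp_incl N) 2)) !raddf0.
- rewrite bar_boundaryD (raddfD (@bar_map _ _ (subgrp_incl N) 2)) !raddfD /=.
  by rewrite IHu IHv.
- by rewrite bar_boundaryZ bar_mapZ !linearZ /= IH.
rewrite bar_map_bar2 bar_boundary_bar2 cochain2E lamP // raddfD raddfB /= !cochain1E.
have qs (z : subgrp N) : qp (s (val z)) = 1%g.
  by rewrite /= sK; apply: qN; have := valP z; rewrite inE.
have qxy : qp (s (val x * val y)%g) = 1%g by rewrite -[(val x * val y)%g]gmulfM qs.
rewrite /c (crossed_ker DM) ?gmulfV ?qxy ?invg1 // (crossed_ker DM) ?qs // (crossed_kerV DM) //.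
rewrite !raddfD raddfN /=.
by apply: freeg_ext => k; rewrite !(coeffB, coeffD, coeffN); ring.
Qed.

Lemma commutator_relation (N : normal_subgroup B) r :
    (forall x, (N : set B) x -> q x = 1%g) -> H2_spanned_by N ->
    p r = 1%g -> commutator_subgroup setT r ->
  exists k, elift d k = 0 /\ aug k = aug (lam r).
Proof.
move=> qN sp pr rE; have [u uE] := commutator_boundary rE.
(* The boundary of [bar_map p u] is [bar1 (p r)], which is [bar1 1]; subtracting [bar2 1 1], with
   the same boundary, gives a cycle. *)
pose z : bar_chain B 2 := bar_map p u - bar2 1%g 1%g.
have z0 : bar_boundary z = 0.
  rewrite /z bar_boundaryB bar_boundary_bar2 -(bar_map_boundary p u) uE bar_map_bar1 pr.
  by rewrite mulg1 subrr add0r subrr.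
have [y [w [y0 zE]]] := H2_spanned_by_chain sp z0.
have Wz : W (Psi z) by rewrite zE raddfD; apply: WD; [exact: Psi_sub | exact: Psi_boundary].
(* The section may send 1 to a nontrivial element of the kernel; the correction [bar2 1 1]
   contributes exactly its class, which completes that of r / s 1 to that of r. *)
have s1 : c 1%g 1%g = s 1%g by rewrite /c mulg1 mulgK.
have ps1 : p (s 1%g) = 1%g by rewrite sK.
have ps : p (r / s 1%g)%g = 1%g by rewrite gmulfF pr ps1 mulgV.
have := alM ps ps1; rewrite mulgVK => W1.
have := Psi_map u; rewrite uE cochain1E pr => W2.
have := WD W1 (WB W2 Wz); congr W.
rewrite /z raddfB /= cochain2E s1 -/(al r).
by apply: freeg_ext => k; rewrite !(coeffB, coeffD, coeffN); ring.
Qed.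

End Lifts.

(** D is additive on the kernel of p, so products of relators and their inverses realize every
    integral combination. *)
Lemma relator_product (u : {freeg 'I_(size R) / int}) :
  exists2 r, p r = 1%g & D r = fglift (D \o relator) u.
Proof.
elim/freeg_int_ind: u => [|k|u v [r pr rE] [t pt tE]].
- by exists 1%g; rewrite ?gmulf1 // (crossed1 DM) raddf0.
- by exists (relator k); [exact: relator_ker | rewrite fgliftU1].
exists (r / t)%g; first by rewrite gmulfF pr pt mulgV.
by rewrite (crossedF DM) (qp_ker pt) invg1 ract1 rE tE raddfB.
Qed.

Lemma H2_spanned_relation (N : normal_subgroup B) c :
    (forall x, (N : set B) x -> q x = 1%g) -> H2_spanned_by N ->
    fglift (aug \o d) c = 0 ->
  exists k, elift d k = 0 /\ aug k = c.
Proof.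
move=> qN sp c0.
have [lam lamP] : {lam & forall e, p e = 1%g -> elift d (lam e) = toQ (D e)}.
  apply: (@choice _ _ (fun e l => p e = 1%g -> elift d l = toQ (D e))) => e.
  have [pe|pe] := pselect (p e = 1%g); last by exists 0.
  by have [l le] := fox_relations pe; exists l.
have [s sK] := choice p_surj.
have [n [c' [n0 cE]]] := toQ_common_denominator c.
have [r pr Dr] := relator_product c'.
have toQD : toQ (D r) = fglift d (c *~ n).
  by rewrite Dr toQ_fglift -cE; exact: eq_fglift.
have rE : commutator_subgroup setT r.
  apply: (fox_abelianization E_free DM Dj); apply: toQ_eq0.
  by rewrite toQ_aug toQD aug_fglift raddfMz /= c0 mul0rz.
have [k [k0 kE]] := commutator_relation lamP sK qN sp pr rE.
pose k1 : {freeg ('I_(size R) * G) / rat} := push (fun i => (i, 1%g)) (c *~ n).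
have dk1 : elift d k1 = toQ (D r).
  by rewrite toQD [LHS]fglift_push; apply: eq_fglift => i /=; exact: ract1.
have ak1 : aug k1 = c *~ n by rewrite /aug push_comp -[RHS]push_id.
(* Both [k1] and [lam r] express D r through the relators, so their augmentations, [c *~ n] and that
   of [lam r], agree modulo [W]. *)
have : W (c *~ n).
  have -> : c *~ n = aug (lam r) - (aug (lam r - k1)).
    by rewrite raddfB /= ak1 subKr.
  apply: WB; first by exists k.
  by exists (lam r - k1); split=> //; rewrite raddfB /= dk1 lamP // subrr.
move/(WZ n%:~R^-1); rewrite -scaler_int scalerA mulVf ?scale1r //.
by rewrite intr_eq0; apply/eqP.
Qed.

End Presentation.

(** * Injectivity on derived quotients *)

Lemma commutator_map (G K : groupType) (f : {ghom G -> K}) x :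
  commutator_subgroup setT x -> commutator_subgroup setT (f x).
Proof. exact: (@derived_map G K f 1). Qed.

Section TorsionRelation.
Context (E B : groupType) (M : normal_subgroup B) (Y : choiceType) (j : Y -> E).
Context (p : {ghom E -> B}) (R : seq E).
Hypothesis p_surj : forall b, exists e, p e = b.
Hypothesis p_ker : forall e, p e = 1%g <-> normal_closure [set r | r \in R] e.

Let q : {ghom B -> quotg M} := \pi_(quotg M).
Let qp : {ghom E -> quotg M} := (q \o p)%FUN.
Variable D : E -> {freeg (Y * quotg M) / int}.
Hypothesis DM : crossed qp D.

Let d k := toQ (D (@relator E R k)).

Let qpE e : qp e = 1%g <-> (M : set B) (p e).
Proof. exact: pi_quotg_eq1. Qed.

(** The graph of the module homomorphism that D induces from M/[M,M] to the free module modulo the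
    rational span of the relators: lift an element of M to E and apply D. *)
Let rel (a : abelianization (subgrp M)) (v : {freeg (Y * quotg M) / int}) :=
  exists e, [/\ (M : set B) (p e), ab_of M (p e) = a & exists l, elift d l = toQ (v - D e)].

Let rel0 : rel 0 0.
Proof.
exists 1%g; rewrite gmulf1 ab_of1 (crossed1 DM); split=> //; first exact: normal1.
by exists 0; rewrite subrr !raddf0.
Qed.

Let relB a b v w : rel a v -> rel b w -> rel (a - b) (v - w).
Proof.
move=> [x [Mx <- [k kE]]] [y [My <- [l lE]]]; exists (x / y)%g.
have MV := normalV My; rewrite gmulfF; split; first exact: normalM.
  by rewrite ab_ofM // ab_ofV.
exists (k - l); rewrite raddfB /= kE lE -raddfB /=; congr toQ.
rewrite (crossedF DM) (qpE y).2 // invg1 ract1.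
by apply: freeg_ext => z; rewrite !(coeffB, coeffD); ring.
Qed.

Let relJ a v g : rel a v -> rel (ab_conj a g) (ract g v).
Proof.
move=> [x [Mx <- [k kE]]]; have [h hE] := p_surj (repr g).
have gE : qp h = g by rewrite /= hE [LHS]reprK.
exists (x ^ h)%g; rewrite gmulfJ; split; first exact: normalJ.
  by rewrite -[g]gE ab_conj_of.
exists (ract g k); rewrite elift_ract kE (crossedJ DM); last exact/qpE.
by rewrite gE -toQ_ract raddfB.
Qed.

Let rel_act a v c : rel a v -> rel (ab_act a c) (act v c).
Proof.
move=> ra; elim/freeg_int_ind: c => [|g|c e IHc IHe].
- by rewrite !raddf0; exact: rel0.
- by rewrite ab_actU1 actU1; exact: relJ.
- by rewrite !raddfB; exact: relB.
Qed.

(** Single-valuedness at 0: an element of E over [M,M] is a product of commutators from the kernel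
    of [qp], on which D vanishes, times an element of the kernel of p, whose image is spanned by the
    relators. *)
Let rel_ker v : rel 0 v -> exists l, elift d l = toQ v.
Proof.
move=> [e [Me /(ab_of_eq0 Me) pe [l lE]]].
have [e' e'K e'E] : exists2 e', commutator_subgroup (kerN qp) e' & p e' = p e.
  move: pe; apply: (generated_min
    (A := [set b | exists2 e', commutator_subgroup (kerN qp) e' & p e' = b])).
    have [K1 KF] := (commutator_subgroup_normal (normal_setP (kerN qp))).1.
    split=> [|_ _ [x xK <-] [y yK <-]]; first by exists 1%g; rewrite ?gmulf1.
    by exists (x / y)%g; [exact: KF | rewrite gmulfF].
  move=> _ [x [y [Mx My ->]]]; have [x' x'E] := p_surj x; have [y' y'E] := p_surj y.
  exists [~ x', y']%g; last by rewrite gmulfR x'E y'E.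
  by apply: generated_sub; exists x', y'; split=> //; apply/qpE; rewrite ?x'E ?y'E.
have pt : p (e'^-1 * e)%g = 1%g by rewrite gmulfM gmulfV e'E mulVg.
have [m mE] := fox_relations p_ker DM pt.
have De : D e = D (e'^-1 * e)%g.
  rewrite (crossed_ker DM); last exact/qpE.
  rewrite (crossedV DM) (crossed_commutator DM e'K).
  by rewrite raddf0 oppr0 add0r.
by exists (l + m); rewrite raddfD /= lE mE -De -raddfD /= subrK.
Qed.

Lemma torsion_relation e c : (M : set B) (p e) -> ab_act (ab_of M (p e)) c = 0 ->
  exists l, elift d l = toQ (act (D e) c).
Proof.
move=> Me ec; apply: rel_ker; rewrite -ec; apply: rel_act.
exists e; split=> //; exists 0; by rewrite subrr !raddf0.
Qed.

End TorsionRelation.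

Section Step.
Context (F B : groupType) (phi : {ghom F -> B}).
Hypothesis F_free : is_free F.
Hypothesis B_fin_rel : finitely_related B.
Hypothesis H1_inj : injective (rat_homology_map phi 1).

Lemma free_quotient_step m (N : normal_subgroup B) :
    (N : set B) `<=` tf_derivedN B m -> H2_spanned_by N ->
    (forall x, (tf_derivedN B m : set B) (phi x) -> (derived F m : set F) x) ->
  forall x, (tf_derivedN B m.+1 : set B) (phi x) -> (derived F m.+1 : set F) x.
Proof.
move=> NM sp IH x; set M := tf_derivedN B m.
have [X0 [i0 F_on]] := F_free; have [E [p [R [[Y0 [j0 E_on]] p_surj p_ker]]]] := B_fin_rel.
pose X : choiceType := {classic X0}; pose Y : choiceType := {classic Y0}.
pose i : X -> F := i0; pose j : Y -> E := j0.
have {}F_on : free_on i by exact: F_on.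
have {}E_on : free_on j by exact: E_on.
pose q : {ghom B -> quotg M} := \pi_(quotg M).
have Gp : ptfa (quotg M) := tf_derived_ptfa B m.
have qE b : q b = 1%g <-> (M : set B) b := pi_quotg_eq1 M b.
have [w0 w0E] := choice (fun z => p_surj (phi (i z))).
have [w wi _] := F_on _ w0.
have pw : forall y, p (w y) = phi y.
  by apply: (free_on_ext F_on (f := (p \o w)%FUN) (f' := phi)) => z /=; rewrite wi.
pose qp : {ghom E -> quotg M} := (q \o p)%FUN.
pose qphi : {ghom F -> quotg M} := (q \o phi)%FUN.
have [D DM Dj] := fox_exists E_on qp.
have [C CM Ci] := fox_exists F_on qphi.
have chain : forall y, D (w y) = elift (fun z => D (w (i z))) (C y).
  by apply: (fox_chain_rule F_on CM Ci DM) => y /=; rewrite pw.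
pose W z := toQ (D (w (i z))); pose d k := toQ (D (@relator E R k)).
have inj : forall a b, elift W a + elift d b = 0 -> a = 0.
  apply: (rank_injective Gp) => [u v uv|c]; last first.
    apply: (H2_spanned_relation E_on p_surj p_ker DM Dj (N := N)) => // b Nb.
    by apply/qE; exact: NM.
  (* Scaled by the common denominator n k, u becomes the exponent vector of some y in F, and the
     v-part comes from a product r of relators. Then w y * r lies in [E,E], so phi y lies in [B,B],
     and injectivity on H_1 makes the exponent sums of y vanish. *)
  have [n [u' [n0 uE]]] := toQ_common_denominator u.
  have [k [v' [k0 vE]]] := toQ_common_denominator v.
  have [y yE] := fox_exponents CM Ci (u' *~ k).
  have [r pr rE] := relator_product p_ker DM (v' *~ n).
  have yrE : commutator_subgroup setT (w y * r)%g.
    apply: (fox_abelianization E_on DM Dj); apply: toQ_eq0.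
    rewrite DM !raddfD /= aug_ract chain rE !toQ_aug toQ_elift toQ_fglift aug_elift aug_fglift.
    rewrite -toQ_aug yE !raddfMz /= -uE -vE.
    have := congr1 (fun z => z *~ (n * k)) uv; rewrite /= mul0rz mulrzDl => <-.
    by rewrite !raddfMz /= -!mulrzA [k * n]mulrC.
  have yB : commutator_subgroup setT (phi y).
    by rewrite -pw -[p (w y)]mulg1 -pr -gmulfM; exact: commutator_map.
  have [t tE] := H1_injective_commutator H1_inj yB.
  have fM : {morph (fun z => toQ (aug (C z))) : y z / (y * z)%g >-> y + z}.
    by move=> z z'; rewrite CM raddfD /= aug_ract raddfD.
  have := cochain1_boundary t fM; rewrite tE cochain1E yE raddfMz /= -uE -mulrzA.
  move/eqP; rewrite -scaler_int scaler_eq0 intr_eq0 mulf_eq0.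
  by move: n0 k0 => /eqP/negPf -> /eqP/negPf -> /eqP.
rewrite tf_derivedS => /torsion_stepP[Mx [c [c0 xc]]].
have kE : (kerN qphi : set F) = derived F m.
  apply/seteqP; split=> y; first by move=> /qE; exact: IH.
  by move=> Fy; apply/qE; apply: derived_sub_tf; exact: derived_map.
have xk : commutator_subgroup (kerN qphi) x.
  have px : qphi x = 1%g by apply/qE.
  apply: (fox_kernel F_on CM Ci px); apply: toQ_eq0.
  have [l lE] : exists l, elift d l = toQ (act (D (w x)) c).
    by apply: (torsion_relation p_surj p_ker DM); rewrite pw.
  (* By the chain rule, [W] sends C x times c to D (w x) times c, which the relators span;
     independence gives (C x) c = 0 and c is cancelled. *)
  apply: (ptfa_no_zero_divisor Gp (c := toQ c)); last by move=> /toQ_eq0.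
  apply: (inj _ (- l)); rewrite elift_act raddfN /= lE toQ_act.
  suff -> : elift W (toQ (C x)) = toQ (D (w x)) by rewrite subrr.
  by rewrite chain toQ_elift.
by rewrite /= -kE.
Qed.

(** The terms decrease, so N lies in every L_m with m <= n and the same spanning hypothesis serves
    each stage of the induction. *)
Lemma free_quotient_injective n (N : normal_subgroup B) :
    (N : set B) `<=` tf_derivedN B n -> H2_spanned_by N ->
  forall m, (m <= n.+1)%N -> forall x,
    (tf_derivedN B m : set B) (phi x) -> (derived F m : set F) x.
Proof.
move=> Nn sp; elim=> // m IHm mn.
apply: free_quotient_step sp (IHm (ltnW mn)) => x /Nn.
exact: tf_derived_anti.
Qed.

End Step.

Theorem corollary2p2 (n : nat) (F B : groupType) (phi : {ghom F -> B})
    (F_free : is_free F) (B_fin_rel : finitely_related B)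
    (H1_inj : injective (rat_homology_map phi 1))
    (H2_span : H2_spanned_by (derived B n) \/ H2_spanned_by (tf_derivedN B n)) :
  injective (derived_quot_map phi n.+1) /\
  forall m : nat, (m <= n.+1)%N -> injective (derived_quot_map phi m).
Proof.
have [N Nn sp] : exists2 N : normal_subgroup B,
    (N : set B) `<=` tf_derivedN B n & H2_spanned_by N.
  case: H2_span => sp; last by exists (tf_derivedN B n).
  by exists (derived B n) => //; exact: derived_sub_tf.
suff inj m : (m <= n.+1)%N -> injective (derived_quot_map phi m).
  by split=> //; exact: inj.
move=> mn a b; rewrite -[a]reprK -[b]reprK !derived_quot_mapE => /quotgP ab.
(* From B^(m) one passes to the larger L_m, whose preimage in F is already contained in F^(m). *)
apply/quotgP; move: ab; rewrite -gmulfV -gmulfM => /derived_sub_tf.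
exact: (free_quotient_injective F_free B_fin_rel H1_inj Nn sp mn).
Qed.
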